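(* Let $\{ g_t, t \in (-\epsilon, \epsilon) \} \subset \mathrm{Riem}(M, \mathcal{V}, g_0)$ be a variation such that $\pi : (M, g_t) \rightarrow (N, g_N)$ is a Riemannian submersion for all $t \in (-\epsilon, \epsilon)$ and such that $$B_t^\sharp X = \sum_{i=n+1}^{n+p} g_0(V_i , X) P_{\mathcal{H}}^t \pi^* W_i \quad\text{for every } X\in\mathfrak{X}_{\mathcal{V}},$$ where $\{ W_{n+1}, \ldots , W_{n+p} \}$ are $g_N$-orthonormal vector fields on $N$ and $\{V_{n+1},\ldots,V_{n+p}\}$ are vertical vector fields on $M$, possibly depending on $t$. Let $\sec_M(X,Y)$ be the sectional curvature of $(M,g_t)$ on the plane field spanned by linearly independent $X,Y \in \mathfrak{X}_M$. Write $\widehat W_i = P_{\mathcal{H}}^t \pi^* W_i$. Then for all $i\neq j$ in $\{n+1,\ldots,n+p\}$ $$\partial_t \sec_M( \widehat W_i , \widehat W_j ) = -\frac{3}{2} \sum_{k=n+1}^{n+p} g_N( [ W_i , W_j ] , W_k )\, g_t( V_k , P_{\mathcal{V}}^t [ \widehat W_i , \widehat W_j ] ) + \frac{3}{2}\, g_t\big( [V_i , \widehat W_j ] + [ \widehat W_i , V_j ] , P_{\mathcal{V}}^t [ \widehat W_i , \widehat W_j ] \big)$$ and $$\begin{aligned} \partial^2_{tt} \sec_M( \widehat W_i , \widehat W_j ) ={}& -\frac{3}{2} \sum_{k=n+1}^{n+p} g_N( [ W_i , W_j ] , W_k )\, g_t( \partial_t V_k , P_{\mathcal{V}}^t [ \widehat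 W_i , \widehat W_j ] ) \\ & - \frac{3}{2} \sum_{k,l=n+1}^{n+p} g_N( [ W_i , W_j ] , W_k )\, g_N( [ W_i , W_j ] , W_l )\, g_t( V_k , V_l ) \\ & + 3 \sum_{k=n+1}^{n+p} g_N( [ W_i , W_j ] , W_k )\, g_t( V_k , [ V_i , \widehat W_j ] + [ \widehat W_i , V_j ] ) \\ & + \frac{3}{2}\, g_t\big( [\partial_t V_i , \widehat W_j ] + [ \widehat W_i , \partial_t V_j ] , P_{\mathcal{V}}^t [ \widehat W_i , \widehat W_j ] \big) \\ & - 3\, g_t( [ V_i , V_j ] , P_{\mathcal{V}}^t [ \widehat W_i , \widehat W_j ] ) \\ & - \frac{3}{2}\, g_t\big( [ V_i , \widehat W_j ] + [ \widehat W_i , V_j ] , [ V_i , \widehat W_j ] + [ \widehat W_i , V_j ] \big). \end{aligned}$$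
   Context: Manifolds are smooth, connected and oriented; all functions and tensor fields are smooth. $\mathfrak{X}_M$ is the set of vector fields on $M$. A Riemannian submersion $\pi:(M,g)\to(N,g_N)$ is a smooth map with $\operatorname{rank}\pi_*=\dim N$ and $g(X,Y)=g_N(\pi_*X,\pi_*Y)$ for all $X,Y$ that are $g$-orthogonal to $\ker\pi_*$. $\mathcal{V}=\ker\pi_*$ is the vertical distribution, $\mathfrak{X}_{\mathcal{V}}$ the set of vertical vector fields (those with values in $\mathcal{V}$), $n=\dim\mathcal{V}$, $n+p=\dim M$ (so $p=\dim N$). $\mathrm{Riem}(M,\mathcal{V},g_0)$ is the set of Riemannian metrics $g$ on $M$ with $g(X,Y)=g_0(X,Y)$ for all $X,Y\in\mathfrak{X}_{\mathcal{V}}$. A variation of $g_0$ is a one-parameter family $\{g_t, t\in(-\epsilon,\epsilon)\}\subset \mathrm{Riem}(M,\mathcal{V},g_0)$ depending smoothly on $t$, whose member at $t=0$ is $g_0$. $\mathcal{H}(t)$ is the $g_t$-orthogonal complement of $\mathcal{V}$; $P_{\mathcal{V}}^t$, $P_{\mathcal{H}}^t$ are the $g_t$-orthogonal projections onto $\mathcal{V}$, $\mathcal{H}(t)$. $B_t=\partial_t g_t$ and $B_t^\sharp$ is defined by $g_t(B_t^\sharp X,Y)=B_t(X,Y)$ for all $X,Y\in\mathfrak{X}_M$. $\pi^*W$ is the $g_0$-horizontal lift of $W\in\mathfrak{X}_N$, i.e. the unique vector field with values in $\mathcal{H}(0)$ with $\pi_*(\pi^*W)=W$. *)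

(* Defs.v *)
From mathcomp Require Export all_boot all_order all_algebra.
From mathcomp Require Export all_classical all_reals all_analysis.
Set Implicit Arguments.
Unset Strict Implicit.
Unset Printing Implicit Defensive.
Export Order.TTheory GRing.Theory Num.Theory.
Export numFieldNormedType.Exports.
Local Open Scope classical_set_scope.
Local Open Scope ring_scope.

Section Calculus.
Context {R : realType}.

Definition partial {m : nat} (i : 'I_m) (f : 'rV[R]_m -> R) : 'rV[R]_m -> R :=
  fun u => 'D_(delta_mx 0 i) f u.

(* For U open; only the values of f on U matter. *)
Fixpoint Ck {m : nat} (k : nat) (U : set 'rV[R]_m) (f : 'rV[R]_m -> R) : Prop :=
  (forall u, U u -> {for u, continuous f}) /\
  if k is k'.+1 then
    forall i : 'I_m,
      (forall u, U u -> derivable f u (delta_mx 0 i)) /\ Ck k' U (partial i f)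
  else True.

Definition Cinf {m : nat} (U : set 'rV[R]_m) (f : 'rV[R]_m -> R) : Prop :=
  forall k, Ck k U f.

End Calculus.

Record chart (R : realType) (m : nat) (T : topologicalType) := Chart {
  dom : set T;
  cod : set 'rV[R]_m;
  to : T -> 'rV[R]_m;
  from : 'rV[R]_m -> T;
  dom_open : open dom;
  cod_open : open cod;
  to_cod : forall x, dom x -> cod (to x);
  from_dom : forall u, cod u -> dom (from u);
  toK : forall x, dom x -> from (to x) = x;
  fromK : forall u, cod u -> to (from u) = u;
  to_continuous : forall x, dom x -> {for x, continuous to};
  from_continuous : forall u, cod u -> {for u, continuous from} }.

Section Transition.
Context {R : realType} {m : nat} {T : topologicalType}.

Definition overlap (a b : chart R m T) : set 'rV[R]_m :=
  cod a `&` from a @^-1` dom b.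

Definition transition (a b : chart R m T) (j : 'I_m) : 'rV[R]_m -> R :=
  fun u => to b (from a u) 0 j.

Definition transition_jacobian (a b : chart R m T) (u : 'rV[R]_m) : 'M[R]_m :=
  \matrix_(i, j) partial i (transition a b j) u.

End Transition.

(* Connected oriented smooth m-manifolds; the orientation is encoded by the
   sign condition on the Jacobians of the atlas. *)
Record manifold (R : realType) (m : nat) := Manifold {
  space :> topologicalType;
  atlas : set (chart R m space);
  space_hausdorff : hausdorff_space space;
  space_second_countable : @second_countable space;
  space_connected : connected [set: space];
  atlas_cover : forall x : space, exists2 a, atlas a & dom a x;
  atlas_smooth : forall a b, atlas a -> atlas b ->
    forall j, Cinf (overlap a b) (transition a b j);
  atlas_oriented : forall a b, atlas a -> atlas b ->
    forall u, overlap a b u -> 0 < \det (transition_jacobian a b u) }.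

Section Manifold.
Context {R : realType} {m : nat} {M : manifold R m}.

Definition smooth_fun (f : M -> R) : Prop :=
  forall a, atlas a -> Cinf (cod a) (f \o from a).

(* Tangent vectors act on functions as directional derivatives.  As functionals
   on all of M -> R they are made to vanish on functions that are not smooth, so
   that Leibniz equality of two of them is equality on C^oo(M). *)
Definition on_smooth (v : (M -> R) -> R) : (M -> R) -> R :=
  fun f => if `[< smooth_fun f >] then v f else 0.

Definition coord_vec (a : chart R m M) (i : 'I_m) (x : M) : (M -> R) -> R :=
  on_smooth (fun f => partial i (f \o from a) (to a x)).

Definition tangent (x : M) : set ((M -> R) -> R) :=
  [set v | exists a (c : 'I_m -> R),
     [/\ atlas a, dom a x & v = \sum_i c i *: coord_vec a i x]].

Definition field : Type := M -> (M -> R) -> R.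

Definition smooth_field (X : field) : Prop :=
  forall a, atlas a -> exists2 c : 'I_m -> M -> R,
    forall i, Cinf (cod a) (c i \o from a) &
    forall x, dom a x -> X x = \sum_i c i x *: coord_vec a i x.

Definition act (X : field) (f : M -> R) : M -> R := fun x => X x f.

Definition bracket (X Y : field) : field :=
  fun x f => X x (act Y f) - Y x (act X f).

Definition tensor2 : Type := M -> ((M -> R) -> R) -> ((M -> R) -> R) -> R.

Definition eval2 (g : tensor2) (X Y : field) : M -> R :=
  fun x => g x (X x) (Y x).

Definition component (g : tensor2) (a : chart R m M) (i j : 'I_m) : M -> R :=
  eval2 g (coord_vec a i) (coord_vec a j).

Definition riem_metric (g : tensor2) : Prop :=
  [/\ forall x (k : R) u v w, tangent x u -> tangent x v -> tangent x w ->
        g x (k *: u + v) w = k * g x u w + g x v w,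
      forall x u v, tangent x u -> tangent x v -> g x u v = g x v u,
      forall x u, tangent x u -> u != 0 -> 0 < g x u u &
      forall a i j, atlas a -> Cinf (cod a) (component g a i j \o from a)].

Definition connection : Type := field -> field -> field.

Definition affine_connection (D : connection) : Prop :=
  [/\ forall X Y, smooth_field X -> smooth_field Y -> smooth_field (D X Y),
      forall f X X' Y, smooth_fun f ->
        smooth_field X -> smooth_field X' -> smooth_field Y ->
        forall x, D (fun y => f y *: X y + X' y) Y x =
                  f x *: D X Y x + D X' Y x &
      forall f X Y Y', smooth_fun f ->
        smooth_field X -> smooth_field Y -> smooth_field Y' ->
        forall x, D X (fun y => f y *: Y y + Y' y) x =
                  act X f x *: Y x + f x *: D X Y x + D X Y' x].

Definition levi_civita (g : tensor2) (D : connection) : Prop :=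
  [/\ affine_connection D,
      forall X Y, smooth_field X -> smooth_field Y ->
        forall x, D X Y x - D Y X x = bracket X Y x &
      forall X Y Z, smooth_field X -> smooth_field Y -> smooth_field Z ->
        forall x, act X (eval2 g Y Z) x =
                  eval2 g (D X Y) Z x + eval2 g Y (D X Z) x].

Definition curvature (D : connection) (X Y Z : field) : field :=
  fun x => D X (D Y Z) x - D Y (D X Z) x - D (bracket X Y) Z x.

(* To be used with D the Levi-Civita connection of g, which is determined by g. *)
Definition sec (g : tensor2) (D : connection) (X Y : field) : M -> R :=
  fun x => eval2 g (curvature D X Y Y) X x /
    (eval2 g X X x * eval2 g Y Y x - eval2 g X Y x ^+ 2).

(* F : R -> M -> R, read through the chart a as a function of (t, u) in
   ]-eps, eps[ x cod a, is smooth in all variables jointly. *)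
Definition time_smooth (eps : R) (a : chart R m M) (F : R -> M -> R) : Prop :=
  @Cinf R (1 + m)
    [set v : 'rV[R]_(1 + m) | `|lsubmx v 0 0| < eps /\ cod a (rsubmx v)]
    (fun v : 'rV[R]_(1 + m) => F (lsubmx v 0 0) (from a (rsubmx v))).

Definition time_smooth_field (eps : R) (X : R -> field) : Prop :=
  forall a, atlas a -> exists2 c : 'I_m -> R -> M -> R,
    forall i, time_smooth eps a (c i) &
    forall t x, `|t| < eps -> dom a x ->
      X t x = \sum_i c i t x *: coord_vec a i x.

Definition dt_field (X : R -> field) (t : R) : field :=
  fun x f => derive1 (fun s => X s x f) t.

Definition dt_tensor (g : R -> tensor2) (t : R) : tensor2 :=
  fun x u v => derive1 (fun s => g s x u v) t.

Definition sharp (g B : tensor2) (x : M) (u : (M -> R) -> R) : (M -> R) -> R :=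
  get [set w | tangent x w /\ forall v, tangent x v -> g x w v = B x u v].

Definition distribution : Type := M -> set ((M -> R) -> R).

Definition tangent_to (V : distribution) (X : field) : Prop :=
  smooth_field X /\ forall x, V x (X x).

Definition Riem (V : distribution) (g0 : tensor2) : set tensor2 :=
  [set g | riem_metric g /\
     forall X Y, tangent_to V X -> tangent_to V Y -> eval2 g X Y =1 eval2 g0 X Y].

Definition variation (V : distribution) (eps : R) (g : R -> tensor2) : Prop :=
  [/\ 0 < eps,
      forall t, `|t| < eps -> Riem V (g 0) (g t) &
      forall a i j, atlas a -> time_smooth eps a (fun t => component (g t) a i j)].

Definition orth (g : tensor2) (V : distribution) : distribution :=
  fun x => [set u | tangent x u /\ forall v, V x v -> g x u v = 0].

Definition proj_V (g : tensor2) (V : distribution) (X : field) : field :=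
  fun x => get [set u | V x u /\ orth g V x (X x - u)].

Definition proj_H (g : tensor2) (V : distribution) (X : field) : field :=
  fun x => get [set u | orth g V x u /\ V x (X x - u)].

End Manifold.

Arguments field {R m} M.
Arguments tensor2 {R m} M.
Arguments connection {R m} M.
Arguments distribution {R m} M.

Section Submersion.
Context {R : realType} {m p : nat} {M : manifold R m} {N : manifold R p}.
Implicit Type pi : M -> N.

Definition smooth_map pi : Prop :=
  continuous pi /\
  forall a b, atlas a -> atlas b ->
    forall j, Cinf (cod a `&` (pi \o from a) @^-1` dom b)
                   (fun u => to b (pi (from a u)) 0 j).

Definition push pi (v : (M -> R) -> R) : (N -> R) -> R :=
  on_smooth (fun f => v (f \o pi)).

Definition rank_at pi (x : M) (r : nat) : Prop :=
  exists b : 'I_r -> (N -> R) -> R,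
    [/\ forall i, exists2 v, tangent x v & push pi v = b i,
        forall c : 'I_r -> R, \sum_i c i *: b i = 0 -> forall i, c i = 0 &
        forall v, tangent x v ->
          exists c : 'I_r -> R, push pi v = \sum_i c i *: b i].

Definition vertical pi : distribution M :=
  fun x => [set v | tangent x v /\ push pi v = 0].

Definition riem_submersion pi (g : tensor2 M) (gN : tensor2 N) : Prop :=
  [/\ smooth_map pi,
      forall x, rank_at pi x p &
      forall x u v, orth g (vertical pi) x u -> orth g (vertical pi) x v ->
        g x u v = gN (pi x) (push pi u) (push pi v)].

Definition hlift pi (g : tensor2 M) (W : field N) : field M :=
  fun x => get [set u | orth g (vertical pi) x u /\ push pi u = W (pi x)].

End Submersion.

(* Main.v *)
Require Import Defs.
From mathcomp Require Import ring lra.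
Set Implicit Arguments.
Unset Strict Implicit.
Unset Printing Implicit Defensive.
Local Open Scope classical_set_scope.
Local Open Scope ring_scope.

(** By O'Neill's formula [sec (What_i, What_j) = K - 3/4 |A|^2], where
    [A = P_V [What_i, What_j]] and [K] depends only on the base.  Each [What_i]
    is the [g_t]-horizontal lift of [W_i], so it is characterised by
    [g_t (What_i, u) = gN (W_i, pi_* u)] for all tangent [u].  Differentiating
    [g_t (What_i, X) = 0] for vertical [X] and using the hypothesis on [B_t]
    gives [dWhat_i/dt = - V_i].  Since the horizontal part of
    [[What_i, What_j]] is [sum_k c_k What_k] with [c_k] constant in time,
    [dA/dt = sum_k c_k V_k - C], again a vertical field, and both formulas follow
    because all the [g_t] agree on vertical fields.

    No connection on the base is needed for O'Neill's formula: [K] is expressed by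
    inner products of brackets of the [W_k] and their first derivatives. *)

(** * Functions of class C^k *)

(** The obstacle is regularity. Tangent vectors are functionals on functions, and lifts, projections
    and [sharp] are picked pointwise by [get], so nothing is smooth, or differentiable in time, by
    construction. Two devices answer this. In a chart the lift is given by the inverse Gram matrix
    of [g t], which shows joint smoothness in time and space. Globally defined cut-off coordinates
    turn differentiability of [v s f] for each [f] into differentiability of the coefficients of
    [v s]. Joint smoothness is also what lets a time derivative cross the spatial derivatives in a
    bracket. The velocity of a lift is vertical, because its push-forward is constant in time. Its
    sum with [V k] is therefore a legitimate vertical test field, and testing this sum against
    itself shows that it vanishes. The factor 3/4 is 1/4, from the inner product of [D X Y] and
    [D Y X], whose vertical parts are plus and minus half of that of the bracket, and 1/2, from the
    covariant derivative along the bracket. Differentiating a square norm doubles it to 3/2. *)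

Section DirectionalDerivative.
Context {R : realType}.

(** A directional derivative sees only the values on one line, so it passes between functions on
    different spaces that agree along matching lines. Restrictions to a line, to fixed time and to
    fixed position are instances. *)
Lemma is_derive_along (V V' W : normedModType R) (f : V -> W) (g : V' -> W)
    x v y w d :
  (forall h : R, f (h *: v + x) = g (h *: w + y)) ->
  is_derive x v f d -> is_derive y w g d.
Proof.
move=> fg [fv <-].
have E : (fun h : R => h^-1 *: ((f \o shift x) (h *: v) - f x)) =
         (fun h : R => h^-1 *: ((g \o shift y) (h *: w) - g y)).
  apply/funext => h /=; have := fg 0; rewrite !scale0r !add0r => ->.
  by rewrite fg.
by split; [rewrite /derivable -E|rewrite /derive -E].
Qed.

Lemma is_derive_line (V W : normedModType R) (f : V -> W) x v s d :
  is_derive (s *: v + x) v f d <-> is_derive s 1 (fun r => f (r *: v + x)) d.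
Proof.
split; apply: is_derive_along => h; rewrite scalerDl addrA.
  by rewrite -scalerA scale1r.
by rewrite -scalerA scale1r.
Qed.

Lemma derivable_line_cvg (V W : normedModType R) (f : V -> W) x v :
  derivable f x v -> f (h *: v + x) @[h --> 0] --> f x.
Proof.
move=> /derivable1P/derivable1_diffP/differentiable_continuous.
by rewrite /prop_for /continuous_at scale0r add0r.
Qed.

(** The increment [k] will be a difference of coordinates, of either sign, so the intermediate point
    is located by absolute values. *)
Lemma mvt_line (V : normedModType R) (f : V -> R) x v (k : R) :
  (forall s : R, `|s| <= `|k| -> derivable f (s *: v + x) v) ->
  exists2 c : R, `|c| <= `|k| & f (k *: v + x) - f x = k * 'D_v f (c *: v + x).
Proof.
move=> df.
have D (s : R) : `|s| <= `|k| ->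
    is_derive s 1 (fun r => f (r *: v + x)) ('D_v f (s *: v + x)).
  by move=> sk; apply/(is_derive_line f x v s); apply: derivableP; exact: df.
have C (i : interval R) : {subset i <= [pred s | `|s| <= `|k|]} ->
    {within [set` i], continuous (fun r => f (r *: v + x))}.
  move=> ik; apply: derivable_within_continuous => s /ik /= sk.
  by have [] := D s sk.
have [k0|k0] := leP 0 k.
- have S : {subset `[0, k] <= [pred s : R | `|s| <= `|k|]}.
    move=> s; rewrite in_itv /= inE => /andP[s0 sk].
    by rewrite !ger0_norm.
  have [|c ck] := @MVT_segment R (fun r => f (r *: v + x))
      (fun r => 'D_v f (r *: v + x)) 0 k k0 _ (C _ S).
    move=> s /subset_itv_oo_cc sk; apply: D; exact: S.
  rewrite scale0r add0r subr0 => ->; exists c; first exact: S.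
  by rewrite mulrC.
- have S : {subset `[k, 0] <= [pred s : R | `|s| <= `|k|]}.
    move=> s; rewrite in_itv /= inE => /andP[s0 sk].
    by rewrite !ler0_norm // ?lerN2 // ltW.
  have [|c ck] := @MVT_segment R (fun r => f (r *: v + x))
      (fun r => 'D_v f (r *: v + x)) k 0 (ltW k0) _ (C _ S).
    move=> s /subset_itv_oo_cc sk; apply: D; exact: S.
  rewrite scale0r add0r sub0r => e; exists c; first exact: S.
  by rewrite -opprB e mulrN opprK mulrC.
Qed.

End DirectionalDerivative.

Section RowVector.
Context {R : realType} {m : nat}.
Implicit Types (u v : 'rV[R]_m).

Lemma rV_coord_norm u i : `|u 0 i| <= `|u|.
Proof.
rewrite [leRHS]/Num.Def.normr /= mx_normrE.
exact: (le_bigmax _ (fun ij : 'I_1 * 'I_m => `|u ij.1 ij.2|) (0, i)).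
Qed.

Lemma rV_norm_le u (c : R) : 0 <= c -> (forall i, `|u 0 i| <= c) -> `|u| <= c.
Proof.
move=> c0 uc; rewrite /Num.Def.normr /= mx_normrE.
by apply: bigmax_le => // -[i j] _ /=; rewrite ord1.
Qed.

Lemma rV_norm_delta (i : 'I_m) : `|delta_mx 0 i : 'rV[R]_m| <= 1.
Proof.
by apply: rV_norm_le => // j; rewrite mxE; case: eqP => _; case: eqP;
  rewrite /= ?normr0 ?normr1.
Qed.

Lemma nbhs_rVP u (A : set 'rV[R]_m) :
  nbhs u A <-> exists2 d, 0 < d & forall v, `|v - u| < d -> A v.
Proof.
split.
- move=> /nbhs_ballP [d /= d0 dA]; exists d => // v vd; apply: dA.
  by rewrite mx_norm_ball /ball_ /= distrC.
- move=> [d d0 dA]; apply/nbhs_ballP; exists d => //= v.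
  by rewrite mx_norm_ball /ball_ /= distrC; exact: dA.
Qed.

Lemma cvg_rV (T : Type) (F : set_system T) (FF : Filter F)
    (f : T -> 'rV[R]_m) u :
  (forall i, f x 0 i @[x --> F] --> u 0 i) -> f @ F --> u.
Proof.
move=> fu; apply/cvgrPdist_lt => e e0.
have e2 : 0 < e / 2 by rewrite divr_gt0.
have H : \forall x \near F, forall i, `|u 0 i - f x 0 i| < e / 2.
  by apply: filter_forall => i; move/cvgrPdist_lt : (fu i); exact.
apply: filterS H => x H.
apply: le_lt_trans (_ : e / 2 < e); last by rewrite ltr_pdivrMr // ltr_pMr // ltr1n.
by apply: rV_norm_le => [|i]; [exact: ltW|rewrite !mxE ltW].
Qed.

End RowVector.

(** * Slopes and the chain rule for functions with continuous partial derivatives *)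

Section Slope.
Context {R : realType} {m : nat}.
Implicit Types (f : 'rV[R]_m -> R) (u v : 'rV[R]_m).

(** One step of the staircase from [u] to [v]: each vertex takes its first coordinates from [v] and
    the others from [u], so consecutive vertices differ along one basis vector. *)
Lemma rV_delta_decomp u (k : 'I_m) (l : nat) v :
  k = l :> nat ->
  (\row_j if (j < l.+1)%N then v 0 j else u 0 j) =
  (v 0 k - u 0 k) *: delta_mx 0 k + \row_j if (j < l)%N then v 0 j else u 0 j.
Proof.
move=> kl; apply/rowP => j; rewrite !mxE eqxx /= ltnS leq_eqVlt -kl.
have -> : (j == k) = (j == k :> nat) by [].
have [e|_] := eqVneq (j : nat) k; last by rewrite mulr0 add0r.
by rewrite e ltnn /= mulr1 (ord_inj e) subrK.
Qed.

(* The Caratheodory form of differentiability: the slopes are difference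
   quotients along the coordinate path from [u] to [v]. *)
Lemma C1_slope f u :
  (forall l : 'I_m, \forall v \near u, derivable f v (delta_mx 0 l)) ->
  (forall l : 'I_m, {for u, continuous (partial l f)}) ->
  exists q : 'I_m -> 'rV[R]_m -> R,
    (forall l, q l v @[v --> u] --> partial l f u) /\
    forall v, f v - f u = \sum_l (v 0 l - u 0 l) * q l v.
Proof.
move=> df cf.
pose hyb (l : nat) v := (\row_j if (j < l)%N then v 0 j else u 0 j) : 'rV[R]_m.
(* Where the quotient would be 0/0 it is given the value of its limit, which keeps both the
   convergence and the telescoping identity. *)
pose q (l : 'I_m) v := if v 0 l == u 0 l then partial l f u else
  (f (hyb l.+1 v) - f (hyb l v)) / (v 0 l - u 0 l).
exists q; split.
- move=> l; apply/(@cvgrPdist_lt _ _ _ (nbhs u)) => e e0.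
  have /nbhs_rVP [d1 d10 D1] := df l.
  have /cvgrPdist_lt/(_ _ e0)/nbhs_rVP [d2 d20 D2] := cf l.
  apply/nbhs_rVP; exists (Num.min d1 d2) => [|v]; first by rewrite lt_min d10.
  rewrite lt_min => /andP[v1 v2].
  rewrite /q; case: ifPn => [_|vl]; first by rewrite subrr normr0.
  have S (s : R) : `|s| <= `|v 0 l - u 0 l| ->
      `|s *: delta_mx 0 l + hyb l v - u| <= `|v - u|.
    move=> sl; apply: rV_norm_le => // j; rewrite !mxE eqxx /=.
    have := rV_coord_norm (v - u) j; rewrite !mxE.
    have [->|jl] := eqVneq j l.
      by rewrite ltnn mulr1 addrK; apply: le_trans.
    rewrite mulr0 add0r; case: ifP => // _.
    by rewrite subrr normr0.
  have [|c cl] := @mvt_line R _ f (hyb l v) (delta_mx 0 l) (v 0 l - u 0 l).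
    by move=> s /S sl; apply: D1; exact: le_lt_trans v1.
  rewrite -(@rV_delta_decomp u l l) // => ->.
  rewrite mulrAC mulfV ?subr_eq0 // mul1r.
  by apply: D2; exact: le_lt_trans (S _ cl) v2.
- move=> v; have -> : f v - f u = f (hyb m v) - f (hyb 0%N v).
    by congr (f _ - f _); apply/rowP => j; rewrite !mxE ?ltn_ord.
  rewrite -(telescope_sumr (fun l => f (hyb l v)) (leq0n m)) big_mkord; apply: eq_bigr => l _.
  rewrite /q; case: ifPn => [/eqP e|vl].
    have := @rV_delta_decomp u l l v erefl; rewrite -/(hyb _ _) -/(hyb _ _) => ->.
    by rewrite e subrr scale0r add0r subrr mul0r.
  by rewrite mulrC mulfVK // subr_eq0.
Qed.

(** The slopes avoid dividing by the increments of the coordinates of [phi], which may vanish; each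
    term is a difference quotient of one coordinate times a convergent slope. *)
Lemma is_derive_comp_C1 (V : normedModType R) (phi : V -> 'rV[R]_m) f x w
    (dphi : 'I_m -> R) :
  (forall l : 'I_m, \forall v \near phi x, derivable f v (delta_mx 0 l)) ->
  (forall l : 'I_m, {for phi x, continuous (partial l f)}) ->
  (forall l, is_derive x w (fun y => phi y 0 l) (dphi l)) ->
  is_derive x w (fun y => f (phi y)) (\sum_l dphi l * partial l f (phi x)).
Proof.
move=> df cf dp.
have [q [cq fq]] := C1_slope df cf.
have phic : phi (h *: w + x) @[h --> 0^'] --> phi x.
  apply: cvg_rV => l.
  have /derivable_line_cvg : derivable (fun y => phi y 0 l) x w by have [] := dp l.
  by move=> H; apply: cvg_trans H; apply: cvg_app; exact: nbhs_dnbhs.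
have L : h^-1 *: (f (phi (h *: w + x)) - f (phi x)) @[h --> 0^'] -->
    \sum_l dphi l * partial l f (phi x).
  have -> : (fun h : R => h^-1 *: (f (phi (h *: w + x)) - f (phi x))) =
     \sum_l (fun h : R => (h^-1 *: (phi (h *: w + x) 0 l - phi x 0 l)) *
            q l (phi (h *: w + x))).
    apply/funext => h; rewrite fq fct_sumE scaler_sumr; apply: eq_bigr => l _.
    by rewrite -scalerAl.
  rewrite fct_sumE; apply: (cvg_big add_continuous) => l _; apply: cvgM.
    by have [/cvg_ex [d dl] <-] := dp l; rewrite /derive (cvg_lim _ dl).
  exact: cvg_comp phic (cq l).
split; first by apply/cvg_ex; eexists; exact: L.
exact: cvg_lim L.
Qed.

End Slope.

(** * Closure properties of the classes C^k *)

Section Ck.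
Context {R : realType} {m : nat}.
Implicit Types (U W : set 'rV[R]_m) (f g : 'rV[R]_m -> R).

Lemma Ck_continuous k U f : Ck k U f -> forall u, U u -> {for u, continuous f}.
Proof. by case: k => [|k] []. Qed.

Lemma Ck_is_derive k U f i u : Ck k.+1 U f -> U u ->
  is_derive u (delta_mx 0 i) f (partial i f u).
Proof. by move=> [_ /(_ i)[df _]] /df; exact: derivableP. Qed.

Lemma Ck_partial k U f i : Ck k.+1 U f -> Ck k U (partial i f).
Proof. by move=> [_ /(_ i)[]]. Qed.

Lemma sub_Ck k U W f : W `<=` U -> Ck k U f -> Ck k W f.
Proof.
move=> WU; elim: k f => [|k IH] f [cf df]; split => //; try by move=> u /WU/cf.
by move=> i; have [di pi] := df i; split; [move=> u /WU/di|exact: IH].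
Qed.

Lemma open_near U f g u : open U -> U u -> (forall v, U v -> f v = g v) ->
  \forall v \near u, f v = g v.
Proof. by move=> oU Uu fg; apply: filterS fg _; exact: open_nbhs_nbhs. Qed.

Lemma eq_Ck k U f g : open U -> (forall u, U u -> f u = g u) ->
  Ck k U f -> Ck k U g.
Proof.
move=> oU; elim: k f g => [|k IH] f g fg [cf df].
- split=> // u Uu; have fgu := open_near oU Uu fg.
  by apply: cvg_trans (near_eq_cvg fgu) _; rewrite -fg //; exact: cf.
- split=> [u Uu|i].
    have fgu := open_near oU Uu fg.
    by apply: cvg_trans (near_eq_cvg fgu) _; rewrite -fg //; exact: cf.
  have [di pi] := df i; split=> [u Uu|].
    by apply: near_eq_derivable (di u Uu); exact: open_near oU Uu fg.
  apply: IH pi => u Uu; apply: near_eq_derive; exact: open_near oU Uu fg.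
Qed.

(** Lets a closure property exhibit the partial derivatives by a formula valid on [U]; the actual
    [partial i f] inherits its class through [eq_Ck], for which [U] must be open. *)
Lemma CkS_intro k U f (df : 'I_m -> 'rV[R]_m -> R) : open U ->
  (forall u, U u -> {for u, continuous f}) ->
  (forall i u, U u -> is_derive u (delta_mx 0 i) f (df i u)) ->
  (forall i, Ck k U (df i)) -> Ck k.+1 U f.
Proof.
move=> oU cf dE dk; split=> // i; split=> [u /(dE i)[]//|].
by apply: eq_Ck oU _ (dk i) => u /(dE i)[].
Qed.

Lemma CkW k U f : Ck k.+1 U f -> Ck k U f.
Proof.
elim: k f => [|k IH] f [cf df]; split=> // i.
by have [? ?] := df i; split=> //; exact: IH.
Qed.

Lemma Ck_local k U f :
  (forall u, U u -> exists W, [/\ open W, W u & Ck k W f]) -> Ck k U f.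
Proof.
elim: k f => [|k IH] f H; split=> //; try by
  move=> u /H [W [_ Wu /Ck_continuous]]; exact.
move=> i; split=> [u /H[W [_ Wu [_ /(_ i)[+ _]]]]|]; first exact.
by apply: IH => u /H[W [oW Wu Wf]]; exists W; split=> //; exact: Ck_partial.
Qed.

Lemma Ck_cst k U (c : R) : open U -> Ck k U (fun=> c).
Proof.
move=> oU; elim: k c => [|k IH] c; first by split=> // u _; exact: cst_continuous.
by apply: (@CkS_intro _ _ _ (fun _ _ => 0)) => // u _; exact: cst_continuous.
Qed.

Lemma Ck_coord k U (i : 'I_m) : open U -> Ck k U (fun u => u 0 i).
Proof.
move=> oU; have C u : U u -> {for u, continuous (fun v : 'rV[R]_m => v 0 i)}.
  by move=> _; exact: coord_continuous.
case: k => [|k]; first by split.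
apply: (@CkS_intro _ _ _ (fun j _ => (delta_mx 0 j : 'rV[R]_m) 0 i)) => //.
  move=> j u _.
  have /derivable_mxP/(_ 0 i) D : derivable id u (delta_mx 0 j : 'rV[R]_m).
    exact: derivable_id.
  split=> //; have := derive_mx (@derivable_id _ _ u (delta_mx 0 j : 'rV[R]_m)).
  by rewrite derive_id => /rowP/(_ i); rewrite [in RHS]mxE.
by move=> j; exact: Ck_cst.
Qed.

Lemma Ck_add k U f g : open U -> Ck k U f -> Ck k U g ->
  Ck k U (fun u => f u + g u).
Proof.
move=> oU; elim: k f g => [|k IH] f g Cf Cg.
  by split=> // u Uu; apply: continuousD; [case: Cf|case: Cg] => + _; exact.
apply: (@CkS_intro _ _ _ (fun i u => partial i f u + partial i g u)) => //.
- by move=> u Uu; apply: continuousD; [exact: Ck_continuous Cf _ Uu|exact: Ck_continuous Cg _ Uu].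
- move=> i u Uu; exact: (is_deriveD (Ck_is_derive i Cf Uu) (Ck_is_derive i Cg Uu)).
- by move=> i; apply: IH; exact: Ck_partial.
Qed.

Lemma Ck_mul k U f g : open U -> Ck k U f -> Ck k U g ->
  Ck k U (fun u => f u * g u).
Proof.
move=> oU; elim: k f g => [|k IH] f g Cf Cg.
  by split=> // u Uu; apply: continuousM; [case: Cf|case: Cg] => + _; exact.
apply: (@CkS_intro _ _ _ (fun i u => f u * partial i g u + g u * partial i f u)).
- by [].
- by move=> u Uu; apply: continuousM; [exact: Ck_continuous Cf _ Uu|exact: Ck_continuous Cg _ Uu].
- move=> i u Uu; exact: (is_deriveM (Ck_is_derive i Cf Uu) (Ck_is_derive i Cg Uu)).
- by move=> i; apply: Ck_add => //; apply: IH; by [exact: CkW|exact: Ck_partial].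
Qed.

Lemma Ck_inv k U f : open U -> (forall u, U u -> f u != 0) -> Ck k U f ->
  Ck k U (fun u => (f u)^-1).
Proof.
move=> oU f0; elim: k => [|k IH] Cf.
  by split=> // u Uu; apply: continuousV; [exact: f0|exact: Ck_continuous Cf _ Uu].
apply: (@CkS_intro _ _ _ (fun i u => -1 * ((f u)^-1 * (f u)^-1 * partial i f u))).
- by [].
- by move=> u Uu; apply: continuousV; [exact: f0|exact: Ck_continuous Cf _ Uu].
- move=> i u Uu; have [dfu dfE] := Ck_is_derive i Cf Uu.
  split; first exact: derivableV (f0 _ Uu) dfu.
  by rewrite (deriveV (f0 _ Uu) dfu) dfE -[_ *: _]/(_ * _) mulN1r mulNr -expr2 exprVn.
- move=> i; have Ci := IH (CkW Cf).
  apply: Ck_mul => //; first exact: Ck_cst.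
  by do 2?[apply: Ck_mul => //]; exact: Ck_partial.
Qed.

Lemma Ck_sum k U (I : Type) (r : seq I) (P : pred I) (F : I -> 'rV[R]_m -> R) :
  open U -> (forall i, P i -> Ck k U (F i)) ->
  Ck k U (fun u => \sum_(i <- r | P i) F i u).
Proof.
move=> oU CF; elim: r => [|i r IH].
  by under eq_fun do rewrite big_nil; exact: Ck_cst.
under eq_fun do rewrite big_cons.
by have [Pi|//] := boolP (P i); apply: Ck_add => //; exact: CF.
Qed.

Lemma Ck_prod k U (I : Type) (r : seq I) (P : pred I) (F : I -> 'rV[R]_m -> R) :
  open U -> (forall i, P i -> Ck k U (F i)) ->
  Ck k U (fun u => \prod_(i <- r | P i) F i u).
Proof.
move=> oU CF; elim: r => [|i r IH].
  by under eq_fun do rewrite big_nil; exact: Ck_cst.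
under eq_fun do rewrite big_cons.
by have [Pi|//] := boolP (P i); apply: Ck_mul => //; exact: CF.
Qed.

End Ck.

Section CkComp.
Context {R : realType}.

Lemma Ck_is_derive_comp (V : normedModType R) m k (U : set 'rV[R]_m) f
    (phi : V -> 'rV[R]_m) x w (dphi : 'I_m -> R) :
  open U -> Ck k.+1 U f -> U (phi x) ->
  (forall l, is_derive x w (fun y => phi y 0 l) (dphi l)) ->
  is_derive x w (fun y => f (phi y)) (\sum_l dphi l * partial l f (phi x)).
Proof.
move=> oU Cf Ux; apply: is_derive_comp_C1.
- move=> l; have : \forall v \near phi x, U v by exact: open_nbhs_nbhs.
  by apply: filterS => v Uv; have [] := Ck_is_derive l Cf Uv.
- by move=> l; exact: Ck_continuous (Ck_partial l Cf) _ Ux.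
Qed.

Lemma Ck_comp m q k (U : set 'rV[R]_m) (W : set 'rV[R]_q)
    (phi : 'rV[R]_m -> 'rV[R]_q) f :
  open U -> open W -> (forall u, U u -> W (phi u)) ->
  (forall l, Ck k U (fun u => phi u 0 l)) -> Ck k W f ->
  Ck k U (fun u => f (phi u)).
Proof.
move=> oU oW UW.
have C0 k' f' : (forall l, Ck k' U (fun u => phi u 0 l)) -> Ck k' W f' ->
    forall u, U u -> {for u, continuous (fun u => f' (phi u))}.
  move=> Cp Cf u Uu; apply: continuous_comp.
    by apply: (@cvg_rV _ _ _ (nbhs u)) => l; exact: Ck_continuous (Cp l) _ Uu.
  exact: Ck_continuous Cf _ (UW _ Uu).
elim: k f => [|k IH] f Cp Cf; first by split=> //; exact: C0 Cp Cf.
apply: (@CkS_intro _ _ _ _ _ (fun i u =>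
  \sum_l partial i (fun v => phi v 0 l) u * partial l f (phi u))) => //.
- exact: C0 Cp Cf.
- move=> i u Uu; apply: (Ck_is_derive_comp oW Cf (UW _ Uu)) => l.
  exact: Ck_is_derive (Cp l) Uu.
- move=> i; apply: Ck_sum => // l _; apply: Ck_mul => //.
    exact: Ck_partial.
  by apply: IH; [move=> l'; exact: CkW|exact: Ck_partial].
Qed.

End CkComp.

(** * Symmetry of second partial derivatives *)

Section Schwarz.
Context {R : realType} {m : nat}.
Implicit Types (U : set 'rV[R]_m) (f : 'rV[R]_m -> R).

(** Two uses of the mean value theorem: on the increment of [f] in direction [j], moving along [i],
    and then on [partial i f], moving along [j]. *)
Lemma second_difference U f u (i j : 'I_m) (d h : R) :
  Ck 2 U f -> 0 < d -> 0 < h -> h + h < d ->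
  (forall v, `|v - u| < d -> U v) ->
  exists2 v, `|v - u| < d &
    f (h *: delta_mx 0 i + (h *: delta_mx 0 j + u)) - f (h *: delta_mx 0 i + u)
    - (f (h *: delta_mx 0 j + u) - f u) = h * (h * partial j (partial i f) v).
Proof.
move=> Cf d0 h0 hd dU.
have B (s r : R) : `|s| <= `|h| -> `|r| <= `|h| ->
    `|s *: delta_mx 0 i + (r *: delta_mx 0 j + u) - u| < d.
  move=> sh rh; rewrite addrA addrK; apply: le_lt_trans hd.
  apply: le_trans (ler_normD _ _) _; rewrite !normrZ; apply: lerD.
    rewrite -[leRHS]mulr1 -[h in leRHS](gtr0_norm h0).
    by apply: ler_pM => //; exact: rV_norm_delta.
  rewrite -[leRHS]mulr1 -[h in leRHS](gtr0_norm h0).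
  by apply: ler_pM => //; exact: rV_norm_delta.
have h00 : `|0 : R| <= `|h| by rewrite normr0.
pose F v := f (h *: delta_mx 0 j + v) - f v.
have D (s : R) : `|s| <= `|h| -> is_derive (s *: delta_mx 0 i + u) (delta_mx 0 i) F
    (partial i f (h *: delta_mx 0 j + (s *: delta_mx 0 i + u))
     - partial i f (s *: delta_mx 0 i + u)).
  move=> sh; apply: is_deriveB.
    apply: (@is_derive_along _ _ _ _ f _ (h *: delta_mx 0 j + (s *: delta_mx 0 i + u)) (delta_mx 0 i)).
      by move=> r; rewrite addrCA.
    apply: (Ck_is_derive _ Cf); apply: dU; rewrite addrCA; exact: B.
  apply: (Ck_is_derive _ Cf); apply: dU.
  by have := B s 0 sh h00; rewrite scale0r add0r.
have [|s sh] := @mvt_line R _ F u (delta_mx 0 i) h.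
  by move=> s /D[].
have [_ ->] := D s sh.
have [|r rh] := @mvt_line R _ (partial i f) (s *: delta_mx 0 i + u) (delta_mx 0 j) h.
  move=> r rh.
  suff Ur : U (r *: delta_mx 0 j + (s *: delta_mx 0 i + u)).
    by have [] := Ck_is_derive j (Ck_partial i Cf) Ur.
  by apply: dU; rewrite addrCA; exact: B.
move=> -> E; exists (r *: delta_mx 0 j + (s *: delta_mx 0 i + u)).
  by rewrite addrCA; exact: B.
by rewrite -E /F addrCA.
Qed.

Lemma dist_half (a b c c' e : R) : c = c' ->
  `|a - c| < e / 2 -> `|b - c'| < e / 2 -> `|a - b| <= e.
Proof.
move=> -> ac bc; rewrite -(subrKA c') [leRHS](splitr e).
by apply: le_trans (ler_normD _ _) _; rewrite (distrC c') lerD // ltW.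
Qed.

(** The second difference is symmetric in [i] and [j], so the two mixed derivatives coincide at two
    points arbitrarily close to [u]; continuity carries the equality to [u] itself. *)
Lemma partialC U f i j u : open U -> Ck 2 U f -> U u ->
  partial i (partial j f) u = partial j (partial i f) u.
Proof.
move=> oU Cf Uu; apply/eqP; rewrite -subr_eq0 -normr_le0; apply/ler_addgt0Pr => e e0.
rewrite add0r.
have e2 : 0 < e / 2 by rewrite divr_gt0.
have /nbhs_rVP [d0 d00 D0] : nbhs u U by exact: open_nbhs_nbhs.
have C a b : {for u, continuous (partial a (partial b f))}.
  exact: Ck_continuous (Ck_partial a (Ck_partial b Cf)) _ Uu.
have /(@cvgrPdist_lt _ _ _ (nbhs u))/(_ _ e2)/nbhs_rVP [d1 d10 D1] := C i j.
have /(@cvgrPdist_lt _ _ _ (nbhs u))/(_ _ e2)/nbhs_rVP [d2 d20 D2] := C j i.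
pose d := Num.min d0 (Num.min d1 d2).
have d_gt0 : 0 < d by rewrite !lt_min d00 d10.
have dU v : `|v - u| < d -> U v by rewrite !lt_min => /andP[/D0].
(* Any positive step with [h + h < d] would do: the point is displaced at most once in each of the
   two directions. *)
pose h := d / 3.
have h0 : 0 < h by rewrite divr_gt0.
have hd : h + h < d by rewrite /h; lra.
have [v1 v1d E1] := @second_difference U f u i j d h Cf d_gt0 h0 hd dU.
have [v2 v2d E2] := @second_difference U f u j i d h Cf d_gt0 h0 hd dU.
have E : partial j (partial i f) v1 = partial i (partial j f) v2.
  have hn0 : h != 0 by rewrite gt_eqF.
  have swap (a b c e' : R) : a - b - (c - e') = a - c - (b - e') by ring.
  apply/(mulfI hn0)/(mulfI hn0); apply: etrans (esym E1) (etrans _ E2).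
  by rewrite swap; congr (f _ - _ - _); exact: addrCA.
move: v1d v2d; rewrite !lt_min => /and3P[_ _ /D2 B1] /and3P[_ /D1 B2 _].
exact: dist_half (esym E) B2 B1.
Qed.

End Schwarz.

Section Cinf.
Context {R : realType} {m : nat}.
Implicit Types (U W : set 'rV[R]_m) (f g : 'rV[R]_m -> R).

Lemma Cinf_continuous U f : Cinf U f -> forall u, U u -> {for u, continuous f}.
Proof. by move=> /(_ 0%N); exact: Ck_continuous. Qed.

Lemma Cinf_is_derive U f i u : Cinf U f -> U u ->
  is_derive u (delta_mx 0 i) f (partial i f u).
Proof. by move=> /(_ 1%N); exact: Ck_is_derive. Qed.

Lemma Cinf_partial U f i : Cinf U f -> Cinf U (partial i f).
Proof. by move=> Cf k; exact: Ck_partial. Qed.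

Lemma sub_Cinf U W f : W `<=` U -> Cinf U f -> Cinf W f.
Proof. by move=> WU Cf k; exact: sub_Ck (Cf k). Qed.

Lemma eq_Cinf U f g : open U -> (forall u, U u -> f u = g u) ->
  Cinf U f -> Cinf U g.
Proof. by move=> oU fg Cf k; exact: eq_Ck (Cf k). Qed.

Lemma Cinf_local U f :
  (forall u, U u -> exists W, [/\ open W, W u & Cinf W f]) -> Cinf U f.
Proof.
move=> H k; apply: Ck_local => u /H[W [oW Wu Cf]]; exists W; split=> //.
Qed.

Lemma Cinf_cst U (c : R) : open U -> Cinf U (fun=> c).
Proof. by move=> oU k; exact: Ck_cst. Qed.

Lemma Cinf_coord U (i : 'I_m) : open U -> Cinf U (fun u => u 0 i).
Proof. by move=> oU k; exact: Ck_coord. Qed.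

Lemma Cinf_add U f g : open U -> Cinf U f -> Cinf U g ->
  Cinf U (fun u => f u + g u).
Proof. by move=> oU Cf Cg k; exact: Ck_add. Qed.

Lemma Cinf_mul U f g : open U -> Cinf U f -> Cinf U g ->
  Cinf U (fun u => f u * g u).
Proof. by move=> oU Cf Cg k; exact: Ck_mul. Qed.

Lemma Cinf_sub U f g : open U -> Cinf U f -> Cinf U g ->
  Cinf U (fun u => f u - g u).
Proof.
move=> oU Cf Cg; apply: Cinf_add => //.
apply: (eq_Cinf (f := fun u => -1 * g u)) => // [u _|]; first by rewrite mulN1r.
by apply: Cinf_mul => //; exact: Cinf_cst.
Qed.

Lemma Cinf_inv U f : open U -> (forall u, U u -> f u != 0) -> Cinf U f ->
  Cinf U (fun u => (f u)^-1).
Proof. by move=> oU f0 Cf k; exact: Ck_inv. Qed.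

Lemma Cinf_sum U (I : Type) (r : seq I) (P : pred I) (F : I -> 'rV[R]_m -> R) :
  open U -> (forall i, P i -> Cinf U (F i)) ->
  Cinf U (fun u => \sum_(i <- r | P i) F i u).
Proof. by move=> oU CF k; apply: Ck_sum => // i /CF. Qed.

Lemma Cinf_prod U (I : Type) (r : seq I) (P : pred I) (F : I -> 'rV[R]_m -> R) :
  open U -> (forall i, P i -> Cinf U (F i)) ->
  Cinf U (fun u => \prod_(i <- r | P i) F i u).
Proof. by move=> oU CF k; apply: Ck_prod => // i /CF. Qed.

Lemma Cinf_det U n (A : 'rV[R]_m -> 'M[R]_n) : open U ->
  (forall i j, Cinf U (fun u => A u i j)) -> Cinf U (fun u => \det (A u)).
Proof.
move=> oU CA; apply: Cinf_sum => // s _; apply: Cinf_mul => //.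
  exact: Cinf_cst.
by apply: Cinf_prod => // i _; exact: CA.
Qed.

(** By Cramer's rule an entry of the inverse is a cofactor divided by the determinant. *)
Lemma Cinf_invmx U n (A : 'rV[R]_m -> 'M[R]_n) i j : open U ->
  (forall u, U u -> A u \in unitmx) ->
  (forall i j, Cinf U (fun u => A u i j)) -> Cinf U (fun u => invmx (A u) i j).
Proof.
move=> oU uA CA.
apply: (eq_Cinf (f := fun u => (\det (A u))^-1 * cofactor (A u) j i)) => //.
  by move=> u /uA uAu; rewrite /invmx uAu !mxE.
apply: Cinf_mul => //.
  apply: Cinf_inv => // [u /uA|]; first by rewrite unitmxE unitfE.
  exact: Cinf_det.
apply: Cinf_mul => //; first exact: Cinf_cst.
apply: Cinf_det => // i' j'.
by apply: (eq_Cinf (f := fun u => A u (lift j i') (lift i j'))) => // u _; rewrite !mxE.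
Qed.

End Cinf.

Lemma Cinf_comp (R : realType) m q (U : set 'rV[R]_m) (W : set 'rV[R]_q)
    (phi : 'rV[R]_m -> 'rV[R]_q) f :
  open U -> open W -> (forall u, U u -> W (phi u)) ->
  (forall l, Cinf U (fun u => phi u 0 l)) -> Cinf W f ->
  Cinf U (fun u => f (phi u)).
Proof. by move=> oU oW UW Cp Cf k; apply: (Ck_comp oU oW UW _ (Cf k)) => l; exact: Cp. Qed.

Lemma open_setI_preimage (S T : topologicalType) (U : set S) (D : set T)
    (f : S -> T) :
  open U -> open D -> (forall u, U u -> {for u, continuous f}) ->
  open (U `&` f @^-1` D).
Proof.
rewrite !openE => oU oD cf u [Uu Du]; apply: filterI; first exact: oU.
by apply: cf => //; exact: oD.
Qed.

(** * Bump functions *)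

Section FlatExp.
Context {R : realType}.

(* The family is closed under differentiation up to smooth factors, which
   makes its smoothness at the origin an induction on the order. *)
Definition flat_exp (n : nat) (x : R) : R :=
  if 0 < x then x^-1 ^+ n * expR (- x^-1) else 0.

(** Keeping one term of the exponential series at [x^-1], of degree n + 2, leaves two spare powers
    of [x]; order two makes the difference quotient at the origin tend to 0. *)
Lemma flat_exp_le n x : `|flat_exp n x| <= n.+2`!%:R * x ^+ 2.
Proof.
rewrite /flat_exp; case: ifPn => [x0|_]; last first.
  by rewrite normr0 mulr_ge0 // sqr_ge0.
have y0 : 0 < x^-1 by rewrite invr_gt0.
rewrite ger0_norm ?mulr_ge0 ?exprn_ge0 ?expR_ge0 ?(ltW y0) // expRN.
rewrite ler_pdivrMr ?expR_gt0 //.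
have := expR_ge1Dxn n.+1 (ltW y0).
move=> /(le_trans _) H; have {}H : x^-1 ^+ n.+2 / n.+2`!%:R <= expR x^-1.
  by apply: H; rewrite lerDr.
have C : 0 <= n.+2`!%:R * x ^+ 2 :> R by rewrite mulr_ge0 // sqr_ge0.
apply: le_trans (ler_wpM2l C H).
rewrite le_eqVlt; apply/orP; left; apply/eqP.
have x0' : x != 0 by rewrite gt_eqF.
have f0 : n.+2`!%:R != 0 :> R by rewrite pnatr_eq0 -lt0n fact_gt0.
rewrite -[n.+2]addn2 exprD mulrACA !expr2 addn2.
by move: f0; move: _`!%:R (_ ^+ n) => F Y F0; field; rewrite F0.
Qed.

(** For positive [x] the exponential contributes the index n + 2 and the power the index n + 1. At
    the origin both vanish, in agreement with the limit given by the quadratic bound. *)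
Lemma flat_exp_derive n (x : R) :
  is_derive x 1 (flat_exp n) (flat_exp n.+2 x - n%:R * flat_exp n.+1 x).
Proof.
have [x0|x0|->] := ltgtP x 0.
- apply: (@near_eq_is_derive _ _ _ (cst 0)).
    near=> y; rewrite /flat_exp ltNge ltW //; near: y; exact: lt_nbhsl.
  by rewrite /flat_exp ltNge (ltW x0) /= mulr0 subr0; exact: is_derive_cst.
- apply: (near_eq_is_derive (f := (fun y : R => y^-1) ^+ n * (fun y : R => expR (- y^-1)))).
    near=> y; rewrite /flat_exp ifT ?fctE //.
    by near: y; exact: lt_nbhsr.
  have xn0 : x != 0 by rewrite gt_eqF.
  have dV : is_derive x 1 (fun y : R => y^-1) (- x ^- 2).
    apply: is_derive_eq (is_deriveV (f := id) xn0 (is_derive_id x 1)) _.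
    by rewrite -[_ *: _]/(_ * _) mulr1.
  have dE : is_derive x 1 (fun y : R => expR (- y^-1)) (expR (- x^-1) * - (- x ^- 2)).
    exact: (@is_derive1_comp _ expR (fun y => - y^-1)).
  have dX : is_derive x 1 ((fun y : R => y^-1) ^+ n) (n%:R * x^-1 ^+ n.-1 * (- x ^- 2)).
    by have := is_deriveX n dV.
  apply: is_derive_eq (is_deriveM dX dE) _.
  rewrite /flat_exp x0 fctE -![_ *: _]/(_ * _) -!exprVn.
  case: n {dX} => [|n] /=; first by rewrite !mul0r !mulr0 !expr0; ring.
  by rewrite !exprS; ring.
- have -> : flat_exp n.+2 (0 : R) - n%:R * flat_exp n.+1 (0 : R) = 0.
    by rewrite /flat_exp ltxx mulr0 subr0.
  have L : h^-1 *: (flat_exp n (h *: 1 + 0) - flat_exp n 0) @[h --> 0^'] --> (0 : R).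
    have -> : flat_exp n (0 : R) = 0 by rewrite /flat_exp ltxx.
    apply/cvgrPdist_le => e e0.
    have C0 : 0 < n.+2`!%:R :> R by rewrite ltr0n fact_gt0.
    near=> h.
    have h0 : h != 0 by near: h; exact: nbhs_dnbhs_neq.
    rewrite sub0r normrN subr0 addr0 normrZ normfV [h *: 1]mulr1.
    rewrite ler_pdivrMl ?normr_gt0 //.
    apply: le_trans (flat_exp_le _ _) _.
    rewrite -real_normK ?num_real // expr2 mulrA mulrC ler_wpM2l //.
    rewrite -ler_pdivlMl //.
    near: h; apply: dnbhs0_le; by rewrite mulr_gt0 // invr_gt0.
  by split; [apply/cvg_ex; eexists; exact: L|exact: cvg_lim L].
Unshelve. all: by end_near. Qed.

Lemma Cinf_flat_exp m (U : set 'rV[R]_m) f n : open U -> Cinf U f ->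
  Cinf U (fun u => flat_exp n (f u)).
Proof.
move=> oU Cf.
have D n' i u : U u -> is_derive u (delta_mx 0 i) (fun v => flat_exp n' (f v))
   ((flat_exp n'.+2 (f u) - n'%:R * flat_exp n'.+1 (f u)) * partial i f u).
  move=> Uu; have [fd fE] := Cinf_is_derive i Cf Uu.
  (* Restricted to a coordinate line the composite is a function of one real variable, to which the
     scalar chain rule applies. *)
  apply: (@is_derive_along _ _ _ _ (fun r : R => flat_exp n' (f (r *: delta_mx 0 i + u))) _ 0 1).
    by move=> h; rewrite addr0 [h *: 1]mulr1.
  apply: (@is_derive1_comp _ (flat_exp n') (fun r : R => f (r *: delta_mx 0 i + u))).
    by rewrite scale0r add0r; exact: flat_exp_derive.
  by apply/(is_derive_line f u _ 0); rewrite scale0r add0r.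
have C n' u : U u -> {for u, continuous (fun v => flat_exp n' (f v))}.
  move=> Uu; apply: continuous_comp; first exact: Cinf_continuous Cf _ Uu.
  have [/derivable1_diffP/differentiable_continuous + _] := flat_exp_derive n' (f u).
  exact.
move=> k; elim: k n => [|k IH] n; first by split=> // u; exact: C.
apply: (@CkS_intro _ _ _ _ _ (fun i u =>
  (flat_exp n.+2 (f u) + (-1 * n%:R) * flat_exp n.+1 (f u)) * partial i f u)) => //.
- by move=> u; exact: C.
- by move=> i u Uu; apply: is_derive_eq (D n i u Uu) _; ring.
- move=> i; apply: Ck_mul => //; last by apply: Ck_partial; exact: Cf.
  apply: Ck_add => //.
  by apply: Ck_mul => //; exact: Ck_cst.
Qed.

End FlatExp.

(** * Extension by zero and cut-off coordinates *)

Section Extension.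
Context {R : realType} {m : nat} {M : manifold R m}.
Implicit Types (a b : chart R m M).

Lemma overlap_open a b : open (overlap a b).
Proof.
apply: open_setI_preimage; [exact: cod_open|exact: dom_open|].
exact: from_continuous.
Qed.

Lemma Cinf_transition_comp a b f (W : set 'rV[R]_m) : atlas a -> atlas b ->
  open W -> W `<=` overlap a b -> Cinf (cod b) f ->
  Cinf W (fun u => f (to b (from a u))).
Proof.
move=> aa ab oW Wab Cf.
apply: (Cinf_comp oW (@cod_open _ _ _ b) _ _ Cf) => [u /Wab[_]|l].
  exact: to_cod.
exact: sub_Cinf Wab (atlas_smooth aa ab l).
Qed.

(** At a point outside [dom a] one needs a neighbourhood on which the extension vanishes. The image
    of [K] is compact, hence closed as the manifold is Hausdorff, and its complement is such a
    neighbourhood. *)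
Lemma smooth_fun_extend a (K : set 'rV[R]_m) (h : 'rV[R]_m -> R) : atlas a ->
  compact K -> K `<=` cod a -> Cinf (cod a) h -> (forall u, h u != 0 -> K u) ->
  smooth_fun (fun x : M => if `[< dom a x >] then h (to a x) else 0).
Proof.
move=> aa cK Ka Ch hK b ab; apply: Cinf_local => u bu.
have [ax|ax] := pselect (dom a (from b u)).
- exists (overlap b a); split=> //; first exact: overlap_open.
  apply: (eq_Cinf (f := fun v => h (to a (from b v)))); first exact: overlap_open.
    by move=> v [_ av] /=; rewrite asboolT.
  exact: (Cinf_transition_comp ab aa (@overlap_open b a)).
- have cKM : closed (from a @` K).
    apply: compact_closed; first exact: space_hausdorff.
    apply: continuous_compact => //.
    apply: continuous_in_subspaceT => v; rewrite inE => /Ka.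
    exact: from_continuous.
  pose W := cod b `&` from b @^-1` ~` (from a @` K).
  have oW : open W.
    apply: open_setI_preimage; [exact: cod_open|exact: closed_openC|].
    exact: from_continuous.
  exists W; split=> //.
    by split=> //= -[v Kv E]; apply: ax; rewrite -E; exact/from_dom/Ka.
  apply: (eq_Cinf (f := fun=> 0)) => //; last exact: Cinf_cst.
  move=> v [_ /= Kv]; case: asboolP => // av; apply/esym/eqP; apply: contrapT.
  by move/negP/hK => K'; apply: Kv; exists (to a (from b v)) => //; rewrite toK.
Qed.

Lemma coord_vecE a i x (f : M -> R) : smooth_fun f ->
  coord_vec a i x f = partial i (f \o from a) (to a x).
Proof. by move=> sf; rewrite /coord_vec /on_smooth asboolT. Qed.

(* Tangent vectors only see globally defined smooth functions, so even the
   linear independence of the coordinate vectors needs cut-off coordinates. *)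
Lemma coord_vec_dual a x : atlas a -> dom a x ->
  exists F : 'I_m -> M -> R, (forall j, smooth_fun (F j)) /\
    forall i j, coord_vec a i x (F j) = (i == j)%:R.
Proof.
move=> aa ax; set u := to a x.
have au : cod a u by exact: to_cod.
have /nbhs_rVP [d d0 dU] : nbhs u (cod a).
  by apply: open_nbhs_nbhs; split=> //; exact: cod_open.
pose r := d / 2; have r0 : 0 < r by rewrite divr_gt0.
have rd : r < d by rewrite ltr_pdivrMr // ltr_pMr // ltr1n.
pose K := [set v : 'rV[R]_m | `|v - u| <= r].
have Ka : K `<=` cod a by move=> v Kv; apply: dU; exact: le_lt_trans rd.
have cK : compact K.
  apply: bounded_closed_compact.
    exists (r + `|u|); split; first exact: num_real.
    move=> M' M'r v Kv; apply: ltW; apply: le_lt_trans M'r.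
    by rewrite /= -(subrK u v); apply: le_trans (ler_normD _ _) _; rewrite lerD2r.
  have -> : K = closed_ball u r.
    by rewrite closed_ballE //; apply/seteqP; split=> v /=; rewrite /K /closed_ball_ /= distrC.
  exact: closed_ball_closed.
(* The norm on row vectors is the maximum norm, which is not smooth, so the bump uses the squared
   Euclidean distance; the Euclidean ball lies in the cube [K] of the same radius. *)
pose rho (v : 'rV[R]_m) : R := flat_exp 0 (r ^+ 2 - \sum_(i < m) (v 0 i - u 0 i) * (v 0 i - u 0 i)).
have Cc (U : set 'rV[R]_m) i : open U -> Cinf U (fun v : 'rV[R]_m => v 0 i - u 0 i).
  by move=> oU; apply: Cinf_sub => //; [exact: Cinf_coord|exact: Cinf_cst].
have oT : open [set: 'rV[R]_m] by exact: openT.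
have Crho : Cinf [set: 'rV[R]_m] rho.
  apply: Cinf_flat_exp => //; apply: Cinf_sub => //; first exact: Cinf_cst.
  by apply: Cinf_sum => // i _; apply: Cinf_mul => //; exact: Cc.
have rhoK v : rho v != 0 -> K v.
  rewrite /rho /flat_exp; case: ifPn => [+ _|_]; last by rewrite eqxx.
  rewrite subr_gt0 => lt; apply: rV_norm_le => [|i]; first exact: ltW.
  rewrite !mxE -ler_sqr ?nnegrE // ?(ltW r0) // real_normK ?num_real //.
  apply: le_trans (ltW lt); rewrite (bigD1 i) //= -expr2 lerDl.
  by apply: sumr_ge0 => j _; rewrite -expr2 sqr_ge0.
have rho0 : rho u != 0.
  rewrite /rho big1 ?subr0 => [|i _]; last by rewrite subrr mul0r.
  by rewrite /flat_exp exprn_gt0 // expr0 mul1r gt_eqF // expR_gt0.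
(* The centred coordinate vanishes at [u], so the derivative of [rho] does not contribute there and
   dividing by [rho u] suffices to normalise. *)
pose h j (v : 'rV[R]_m) : R := (rho u)^-1 * ((v 0 j - u 0 j) * rho v).
have Ch j : Cinf [set: 'rV[R]_m] (h j).
  by apply: Cinf_mul => //; [exact: Cinf_cst|apply: Cinf_mul => //; exact: Cc].
have sF j : smooth_fun (fun y : M => if `[< dom a y >] then h j (to a y) else 0).
  apply: smooth_fun_extend cK Ka _ _ => //; first exact: sub_Cinf (Ch j).
  move=> v; rewrite /h mulf_eq0 negb_or => /andP[_].
  by rewrite mulf_eq0 negb_or => /andP[_ /rhoK].
exists (fun j y => if `[< dom a y >] then h j (to a y) else 0); split=> // i j.
rewrite coord_vecE // -/u.
have : {near u, h j =1 (fun y : M => if `[< dom a y >] then h j (to a y) else 0) \o from a}.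
  apply: (@open_near _ _ (cod a)) => //; first exact: cod_open.
  by move=> v av /=; rewrite asboolT ?fromK //; exact: from_dom.
move=> nE; rewrite /partial -(near_eq_derive _ nE).
have dc := Cinf_is_derive i (Cc _ j oT) (I : [set: 'rV[R]_m] u).
have dr := Cinf_is_derive i Crho (I : [set: 'rV[R]_m] u).
have dk := Cinf_is_derive i (Cinf_cst (rho u)^-1 oT) (I : [set: 'rV[R]_m] u).
have [_ ->] := is_deriveM dk (is_deriveM dc dr).
rewrite -![_ *: _]/(_ * _) /= subrr mul0r add0r.
have -> : partial i (fun=> (rho u)^-1) u = 0 by exact: derive_cst.
rewrite mulr0 addr0 mulKf //.
have -> : partial i (fun v : 'rV[R]_m => v 0 j - u 0 j) u = (delta_mx 0 i : 'rV[R]_m) 0 j.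
  have D : derivable id u (delta_mx 0 i : 'rV[R]_m) by exact: derivable_id.
  have /derivable_mxP/(_ 0 j) D' := D.
  rewrite /partial; have := deriveB D' (derivable_cst (u 0 j) u (delta_mx 0 i)).
  rewrite derive_cst subr0 => ->.
  by have := derive_mx D; rewrite derive_id => /rowP/(_ j); rewrite [in RHS]mxE => <-.
by rewrite mxE eqxx eq_sym.
Qed.

End Extension.

(** * Tangent vectors, fields and metrics *)

Section Tangent.
Context {R : realType} {m : nat} {M : manifold R m}.
Implicit Types (a b : chart R m M) (f : M -> R) (v w : (M -> R) -> R).

Lemma fct_lincombE (T : Type) (k : nat) (c : 'I_k -> R) (w : 'I_k -> T -> R) (f : T) :
  (\sum_i c i *: w i) f = \sum_i c i * w i f.
Proof. by rewrite fct_sumE. Qed.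

Lemma smooth_fun_cst (c : R) : smooth_fun (fun _ : M => c).
Proof. by move=> a _; apply: Cinf_cst; exact: cod_open. Qed.

Lemma smooth_fun_mul f f' : smooth_fun f -> smooth_fun f' ->
  smooth_fun (fun x => f x * f' x).
Proof. by move=> sf sf' a aa; apply: Cinf_mul; [exact: cod_open|exact: sf|exact: sf']. Qed.

Lemma coord_vec_change a b i x : atlas a -> atlas b -> dom a x -> dom b x ->
  coord_vec b i x =
  \sum_j partial i (transition b a j) (to b x) *: coord_vec a j x.
Proof.
move=> aa ab ax bx; apply/funext => f; rewrite fct_lincombE.
have [sf|sf] := pselect (smooth_fun f); last first.
  rewrite /coord_vec /on_smooth !asboolF // big1 // => j _.
  by rewrite mulr0.
have xba : overlap b a (to b x) by split; [exact: to_cod|rewrite /= toK].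
under eq_bigr do rewrite coord_vecE //.
rewrite coord_vecE //.
have E : {near to b x, (fun u => (f \o from a) (to a (from b u))) =1 f \o from b}.
  apply: (@open_near _ _ (overlap b a)) => //; first exact: overlap_open.
  by move=> u [_ au] /=; rewrite toK.
have axa : cod a (to a (from b (to b x))) by rewrite toK //; exact: to_cod.
have [_] := @Ck_is_derive_comp R _ m 0 (cod a) (f \o from a)
  (fun u => to a (from b u)) (to b x) (delta_mx 0 i)
  (fun j => partial i (transition b a j) (to b x))
  (@cod_open _ _ _ a) (sf a aa 1%N) axa
  (fun j => Cinf_is_derive i (atlas_smooth ab aa j) xba).
by rewrite (near_eq_derive _ E) [from b (to b x)]toK.
Qed.

Lemma tangent_vanish x v f : tangent x v -> ~ smooth_fun f -> v f = 0.
Proof.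
move=> [a [c [_ _ ->]]] sf; rewrite fct_lincombE big1 // => i _.
by rewrite /coord_vec /on_smooth asboolF // mulr0.
Qed.

Lemma tangent_coord a x v : atlas a -> dom a x -> tangent x v ->
  exists c, v = \sum_i c i *: coord_vec a i x.
Proof.
move=> aa ax [b [c [ab bx ->]]].
exists (fun j => \sum_i c i * partial i (transition b a j) (to b x)).
under eq_bigr do rewrite (coord_vec_change _ aa ab ax bx) scaler_sumr.
rewrite exchange_big /=; apply: eq_bigr => j _.
by rewrite scaler_suml; apply: eq_bigr => i _; rewrite scalerA.
Qed.

Lemma lincomb_tangent a x c : atlas a -> dom a x ->
  tangent x (\sum_i c i *: coord_vec a i x).
Proof. by move=> aa ax; exists a, c. Qed.

Lemma coord_vec_tangent a x i : atlas a -> dom a x -> tangent x (coord_vec a i x).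
Proof.
move=> aa ax; exists a, (fun j => (j == i)%:R); split=> //.
rewrite (bigD1 i) //= eqxx scale1r big1 ?addr0 // => j ji.
by rewrite (negbTE ji) scale0r.
Qed.

Lemma tangent0 (x : M) : tangent x 0.
Proof.
have [a aa ax] := atlas_cover x; exists a, (fun=> 0); split=> //.
by rewrite big1 // => i _; rewrite scale0r.
Qed.

Lemma tangent_lin (x : M) (k : R) v w : tangent x v -> tangent x w ->
  tangent x (k *: v + w).
Proof.
have [a aa ax] := atlas_cover x => /(tangent_coord aa ax)[c ->].
move=> /(tangent_coord aa ax)[d ->]; exists a, (fun i => k * c i + d i).
split=> //; rewrite scaler_sumr -big_split; apply: eq_bigr => i _ /=.
by rewrite scalerDl scalerA.
Qed.

Lemma tangentD x v w : tangent x v -> tangent x w -> tangent x (v + w).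
Proof. by move=> tv tw; rewrite -[v]scale1r; exact: tangent_lin. Qed.

Lemma tangentZ (x : M) (k : R) v : tangent x v -> tangent x (k *: v).
Proof. by move=> tv; rewrite -[_ *: _]addr0; apply: tangent_lin => //; exact: tangent0. Qed.

Lemma tangentB x v w : tangent x v -> tangent x w -> tangent x (v - w).
Proof. by move=> tv tw; rewrite addrC -scaleN1r; exact: tangent_lin. Qed.

Lemma tangent_sum (x : M) (I : Type) (r : seq I) (P : pred I) F :
  (forall i, P i -> tangent x (F i)) -> tangent x (\sum_(i <- r | P i) F i).
Proof.
by move=> H; apply: big_ind => //; [exact: tangent0|exact: tangentD].
Qed.

(** Coefficients are values of [v] on fixed functions, so a curve of tangent vectors known only
    through its values on functions has coefficients that can be differentiated. *)
Lemma tangent_dual a x (F : 'I_m -> M -> R) v : atlas a -> dom a x ->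
  (forall i j, coord_vec a i x (F j) = (i == j)%:R) ->
  tangent x v -> v = \sum_i v (F i) *: coord_vec a i x.
Proof.
move=> aa ax dF /(tangent_coord aa ax)[c ->]; apply: eq_bigr => i _.
congr (_ *: _); rewrite fct_lincombE (bigD1 i) //= dF eqxx mulr1 big1 ?addr0 //.
by move=> j ji; rewrite dF (negbTE ji) mulr0.
Qed.

Lemma coord_vec_free a x (c d : 'I_m -> R) : atlas a -> dom a x ->
  \sum_i c i *: coord_vec a i x = \sum_i d i *: coord_vec a i x -> c =1 d.
Proof.
move=> aa ax E i; have [F [_ dF]] := coord_vec_dual aa ax.
have ev (e : 'I_m -> R) : (\sum_i e i *: coord_vec a i x) (F i) = e i.
  rewrite fct_lincombE (bigD1 i) //= dF eqxx mulr1 big1 ?addr0 // => j ji.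
  by rewrite dF (negbTE ji) mulr0.
by rewrite -ev E ev.
Qed.

End Tangent.

(** * Vector fields, their action on functions, and brackets *)

Section Field.
Context {R : realType} {m : nat} {M : manifold R m}.
Implicit Types (a b : chart R m M) (f : M -> R) (X Y Z : field M).

Lemma smooth_field_tangent X x : smooth_field X -> tangent x (X x).
Proof.
move=> sX; have [a aa ax] := atlas_cover x.
by have [c _ ->//] := sX a aa; exact: lincomb_tangent.
Qed.

Lemma smooth_field_lin f X Y : smooth_fun f -> smooth_field X -> smooth_field Y ->
  smooth_field (fun x => f x *: X x + Y x).
Proof.
move=> sf sX sY a aa; have [c sc cE] := sX a aa; have [d sd dE] := sY a aa.
exists (fun i x => f x * c i x + d i x).
  move=> i; apply: Cinf_add => //; first exact: cod_open.
    by apply: Cinf_mul; [exact: cod_open|exact: sf|exact: sc].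
  exact: sd.
move=> x ax; rewrite cE // dE // scaler_sumr -big_split; apply: eq_bigr => i _ /=.
by rewrite scalerDl scalerA.
Qed.

Lemma smooth_fieldD X Y : smooth_field X -> smooth_field Y -> smooth_field (X + Y).
Proof.
move=> sX sY; have -> : X + Y = (fun x => (1 : R) *: X x + Y x).
  by apply/funext => x; rewrite scale1r.
by apply: smooth_field_lin => //; exact: smooth_fun_cst.
Qed.

Lemma smooth_field0 : smooth_field (0 : field M).
Proof.
move=> a aa; exists (fun _ _ => 0); first by move=> i; apply: Cinf_cst; exact: cod_open.
by move=> x _; rewrite big1 // => i _; rewrite scale0r.
Qed.

Lemma smooth_fieldM f X : smooth_fun f -> smooth_field X ->
  smooth_field (fun x => f x *: X x).
Proof.
move=> sf sX; have := smooth_field_lin sf sX smooth_field0.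
by congr smooth_field; apply/funext => x; exact: addr0.
Qed.

Lemma smooth_field_sum (I : Type) (r : seq I) (P : pred I) (F : I -> field M) :
  (forall i, P i -> smooth_field (F i)) ->
  smooth_field (\sum_(i <- r | P i) F i).
Proof.
by move=> H; apply: big_ind => //; [exact: smooth_field0|exact: smooth_fieldD].
Qed.

Lemma act_coord a X (c : 'I_m -> M -> R) f u : atlas a -> smooth_fun f -> cod a u ->
  (forall x, dom a x -> X x = \sum_i c i x *: coord_vec a i x) ->
  act X f (from a u) = \sum_i c i (from a u) * partial i (f \o from a) u.
Proof.
move=> aa sf au cE; rewrite /act cE ?fct_lincombE; last exact: from_dom.
by apply: eq_bigr => i _; rewrite coord_vecE // fromK.
Qed.

Lemma smooth_act X f : smooth_field X -> smooth_fun f -> smooth_fun (act X f).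
Proof.
move=> sX sf a aa; have [c sc cE] := sX a aa.
apply: (eq_Cinf (f := fun u => \sum_i c i (from a u) * partial i (f \o from a) u)).
- exact: cod_open.
- by move=> u au; rewrite /= (act_coord aa sf au cE).
apply: Cinf_sum => [|i _]; first exact: cod_open.
apply: Cinf_mul; [exact: cod_open|exact: sc|].
by apply: Cinf_partial; exact: sf.
Qed.

(** The second-order term is kept apart for two uses: it cancels in the bracket, and with [f] fixed
    its time dependence sits in the coefficients alone. *)
Lemma act_act_coord a X Y (c d : 'I_m -> M -> R) f u :
  atlas a -> smooth_fun f -> cod a u -> smooth_field Y ->
  (forall x, dom a x -> X x = \sum_i c i x *: coord_vec a i x) ->
  (forall x, dom a x -> Y x = \sum_i d i x *: coord_vec a i x) ->
  (forall i, Cinf (cod a) (d i \o from a)) ->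
  X (from a u) (act Y f) = \sum_i \sum_j c i (from a u) *
    (d j (from a u) * partial i (partial j (f \o from a)) u
     + partial j (f \o from a) u * partial i (d j \o from a) u).
Proof.
move=> aa sf au sY cE dE sd.
rewrite -[LHS]/(act X (act Y f) (from a u)) (act_coord aa _ au cE); last exact: smooth_act.
apply: eq_bigr => i _; rewrite -mulr_sumr; congr (_ * _).
have E : {near u, (\sum_j ((d j \o from a) * partial j (f \o from a)))
    =1 act Y f \o from a}.
  apply: (@open_near _ _ (cod a)) => //; first exact: cod_open.
  by move=> v av /=; rewrite (act_coord aa sf av dE) fct_sumE.
rewrite /partial -(near_eq_derive _ E) -/(partial i).
have D j : is_derive u (delta_mx 0 i) ((d j \o from a) * partial j (f \o from a))
    (d j (from a u) * partial i (partial j (f \o from a)) u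
     + partial j (f \o from a) u * partial i (d j \o from a) u).
  apply: (is_deriveM (Cinf_is_derive i (sd j) au) (Cinf_is_derive i _ au)).
  by apply: Cinf_partial; exact: sf.
by have [_ ->] := is_derive_sum D.
Qed.

Lemma act_nonsmooth X f : smooth_field X -> ~ smooth_fun f -> act X f = fun=> 0.
Proof.
move=> sX sf; apply/funext => x; rewrite /act.
exact: tangent_vanish (smooth_field_tangent x sX) sf.
Qed.

Lemma coord_vec_cst a i x (c : R) : coord_vec a i x (fun=> c) = 0.
Proof. rewrite coord_vecE; [exact: derive_cst|exact: smooth_fun_cst]. Qed.

Lemma tangent_cst x v (c : R) : tangent x v -> v (fun _ : M => c) = 0.
Proof.
move=> [a [e [_ _ ->]]]; rewrite fct_lincombE big1 // => i _.
by rewrite coord_vec_cst mulr0.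
Qed.

(** Here [act Y f] is the zero function, which is smooth; its image is 0 because tangent vectors
    annihilate constants, not by the convention on functions that are not smooth. *)
Lemma bracket_nonsmooth X Y x f : smooth_field X -> smooth_field Y ->
  ~ smooth_fun f -> bracket X Y x f = 0.
Proof.
move=> sX sY sf; rewrite /bracket !act_nonsmooth //.
rewrite (tangent_cst 0 (smooth_field_tangent x sX)).
by rewrite (tangent_cst 0 (smooth_field_tangent x sY)) subr0.
Qed.

(** The second-order terms of the two compositions agree by symmetry of the mixed derivatives; what
    remains is of first order with smooth coefficients. *)
Lemma smooth_bracket X Y : smooth_field X -> smooth_field Y ->
  smooth_field (bracket X Y).
Proof.
move=> sX sY a aa; have [c sc cE] := sX a aa; have [d sd dE] := sY a aa.
exists (fun j x => \sum_i (c i x * partial i (d j \o from a) (to a x)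
                     - d i x * partial i (c j \o from a) (to a x))).
  move=> j; apply: (eq_Cinf (f := fun u =>
    \sum_i ((c i \o from a) u * partial i (d j \o from a) u
            - (d i \o from a) u * partial i (c j \o from a) u))).
  - exact: cod_open.
  - by move=> u au /=; rewrite fromK.
  apply: Cinf_sum => [|i _]; first exact: cod_open.
  by apply: Cinf_sub; [exact: cod_open|..]; apply: Cinf_mul => //;
    do ?[exact: cod_open|exact: Cinf_partial].
move=> x ax; apply/funext => f; rewrite fct_lincombE.
have [sf|sf] := pselect (smooth_fun f); last first.
  rewrite bracket_nonsmooth // big1 // => i _.
  by rewrite (tangent_vanish (coord_vec_tangent i aa ax) sf) mulr0.
have au := to_cod ax.
rewrite /bracket -[x in X x](toK ax) -[x in Y x](toK ax).
rewrite (act_act_coord aa sf au sY cE dE sd) (act_act_coord aa sf au sX dE cE sc).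
rewrite toK //.
under [RHS]eq_bigr do rewrite coord_vecE // mulr_suml.
rewrite [RHS]exchange_big /=.
pose S i j := partial i (partial j (f \o from a)) (to a x).
have H : \sum_i \sum_j c i x * d j x * S i j = \sum_i \sum_j d i x * c j x * S i j.
  rewrite exchange_big /=; apply: eq_bigr => i _; apply: eq_bigr => j _.
  by rewrite /S (partialC _ _ (@cod_open _ _ _ a) (sf a aa 2%N) au) (mulrC (c _ _)).
transitivity (\sum_i (\sum_j c i x * d j x * S i j +
    \sum_j c i x * partial j (f \o from a) (to a x) * partial i (d j \o from a) (to a x))
  - \sum_i (\sum_j d i x * c j x * S i j +
    \sum_j d i x * partial j (f \o from a) (to a x) * partial i (c j \o from a) (to a x))).
  by congr (_ - _); apply: eq_bigr => i _; rewrite -big_split; apply: eq_bigr => j _;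
    rewrite mulrDr !mulrA.
rewrite [X in X - _]big_split [X in _ - X]big_split /= H opprD addrACA subrr add0r -sumrB; apply: eq_bigr => i _.
rewrite -sumrB; apply: eq_bigr => j _.
by rewrite mulrBl; congr (_ - _); rewrite mulrAC.
Qed.

End Field.

(** * Riemannian metrics, Gram matrices and duality *)

Section Metric.
Context {R : realType} {m : nat} {M : manifold R m}.
Variable g : tensor2 M.
Hypothesis gM : riem_metric g.
Implicit Types (a : chart R m M) (X Y : field M) (u v w : (M -> R) -> R).

Lemma metric_linl x (k : R) u v w : tangent x u -> tangent x v -> tangent x w ->
  g x (k *: u + v) w = k * g x u w + g x v w.
Proof. by case: gM => H _ _ _; exact: H. Qed.

Lemma metricC x u v : tangent x u -> tangent x v -> g x u v = g x v u.
Proof. by case: gM => _ H _ _; exact: H. Qed.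

Lemma metric0l x w : tangent x w -> g x 0 w = 0.
Proof.
move=> tw; have := metric_linl 1 (tangent0 x) (tangent0 x) tw.
by rewrite scaler0 addr0 mul1r => E; apply/esym; apply: (addrI (g x 0 w)); rewrite -E addr0.
Qed.

Lemma metricDl x u v w : tangent x u -> tangent x v -> tangent x w ->
  g x (u + v) w = g x u w + g x v w.
Proof. by move=> tu tv tw; rewrite -{1}[u]scale1r metric_linl // mul1r. Qed.

Lemma metricZl x (k : R) u w : tangent x u -> tangent x w ->
  g x (k *: u) w = k * g x u w.
Proof.
move=> tu tw; rewrite -[k *: u]addr0 metric_linl ?metric0l ?addr0 //.
exact: tangent0.
Qed.

Lemma metricBl x u v w : tangent x u -> tangent x v -> tangent x w ->
  g x (u - v) w = g x u w - g x v w.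
Proof. by move=> tu tv tw; rewrite addrC -scaleN1r metric_linl // mulN1r addrC. Qed.

Lemma metric_suml x (I : Type) (r : seq I) (P : pred I) (c : I -> R) F w :
  (forall i, P i -> tangent x (F i)) -> tangent x w ->
  g x (\sum_(i <- r | P i) c i *: F i) w = \sum_(i <- r | P i) c i * g x (F i) w.
Proof.
move=> tF tw; pose K u s := tangent x u /\ g x u w = s.
suff : K (\sum_(i <- r | P i) c i *: F i) (\sum_(i <- r | P i) c i * g x (F i) w).
  by case.
apply: (big_rec2 K) => [|i s u Pi [tu us]]; first by split; [exact: tangent0|exact: metric0l].
by split; [apply: tangent_lin => //; exact: tF|rewrite metric_linl ?us //; exact: tF].
Qed.

Lemma metricDr x u v w : tangent x u -> tangent x v -> tangent x w ->
  g x w (u + v) = g x w u + g x w v.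
Proof.
by move=> tu tv tw; rewrite metricC ?metricDl 1?(metricC tu) 1?(metricC tv) //; exact: tangentD.
Qed.

Lemma metricBr x u v w : tangent x u -> tangent x v -> tangent x w ->
  g x w (u - v) = g x w u - g x w v.
Proof.
by move=> tu tv tw; rewrite metricC ?metricBl 1?(metricC tu) 1?(metricC tv) //; exact: tangentB.
Qed.

Lemma metricZr x (k : R) u w : tangent x u -> tangent x w ->
  g x w (k *: u) = k * g x w u.
Proof.
by move=> tu tw; rewrite metricC ?metricZl 1?(metricC tu) //; exact: tangentZ.
Qed.

Lemma metric_sumr x (I : Type) (r : seq I) (P : pred I) (c : I -> R) F w :
  (forall i, P i -> tangent x (F i)) -> tangent x w ->
  g x w (\sum_(i <- r | P i) c i *: F i) = \sum_(i <- r | P i) c i * g x w (F i).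
Proof.
move=> tF tw; rewrite metricC ?metric_suml //.
  by apply: eq_bigr => i Pi; rewrite metricC //; exact: tF.
by apply: tangent_sum => i Pi; apply: tangentZ; exact: tF.
Qed.

Lemma metric_coord a x (c d : 'I_m -> R) : atlas a -> dom a x ->
  g x (\sum_i c i *: coord_vec a i x) (\sum_j d j *: coord_vec a j x) =
  \sum_i \sum_j c i * d j * component g a i j x.
Proof.
move=> aa ax; have tc i : tangent x (coord_vec a i x) by exact: coord_vec_tangent.
rewrite metric_suml //; last by apply: tangent_sum => j _; exact: tangentZ.
apply: eq_bigr => i _; rewrite metric_sumr // mulr_sumr.
by apply: eq_bigr => j _; rewrite mulrA.
Qed.

Lemma metric_eq0 x u : tangent x u -> g x u u = 0 -> u = 0.
Proof.
case: gM => _ _ pos _ tu gu; apply/eqP; apply: contrapT => /negP u0.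
by have := pos x u tu u0; rewrite gu ltxx.
Qed.

Lemma metric_inj x u v : tangent x u -> tangent x v ->
  (forall w, tangent x w -> g x u w = g x v w) -> u = v.
Proof.
move=> tu tv uv; apply/eqP; rewrite -subr_eq0; apply/eqP; apply: (@metric_eq0 x).
  exact: tangentB.
by rewrite metricBl ?uv ?subrr //; exact: tangentB.
Qed.

Lemma smooth_eval2 X Y : smooth_field X -> smooth_field Y -> smooth_fun (eval2 g X Y).
Proof.
move=> sX sY a aa; have [c sc cE] := sX a aa; have [d sd dE] := sY a aa.
apply: (eq_Cinf (f := fun u : 'rV[R]_m => \sum_i \sum_j c i (from a u) * d j (from a u) *
   component g a i j (from a u))).
- exact: cod_open.
- by move=> u /from_dom au; rewrite /= /eval2 cE // dE // metric_coord.
have oa := @cod_open _ _ _ a.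
apply: Cinf_sum => // i _; apply: Cinf_sum => // j _.
apply: Cinf_mul => //; first by apply: Cinf_mul; [|exact: sc|exact: sd].
by case: gM => _ _ _; exact.
Qed.

Definition gram a x : 'M[R]_m := \matrix_(i, j) component g a i j x.

(** A row vector in the kernel gives a tangent vector of length zero, and the coordinate vectors are
    independent. *)
Lemma gram_unit a x : atlas a -> dom a x -> gram a x \in unitmx.
Proof.
move=> aa ax; rewrite unitmxE unitfE; apply/det0P => -[v v0 vG].
pose u := \sum_i v 0 i *: coord_vec a i x.
have u0 : u = 0.
  apply: (@metric_eq0 x); first exact: lincomb_tangent.
  rewrite metric_coord // exchange_big /= big1 // => j _.
  transitivity (v 0 j * (v *m gram a x) 0 j); last by rewrite vG mxE mulr0.
  by rewrite mxE mulr_sumr; apply: eq_bigr => i _; rewrite mxE mulrCA mulrA.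
have /(coord_vec_free aa ax) E : \sum_i v 0 i *: coord_vec a i x =
    \sum_i 0 *: coord_vec a i x.
  by rewrite -/u u0 big1 // => i _; rewrite scale0r.
by move/eqP: v0; apply; apply/rowP => i; rewrite E mxE.
Qed.

(** Raising an index: the coordinates of the vector dual to the covector with components [theta].
    The explicit inverse matrix makes smooth dependence on the metric visible. *)
Definition riesz_coord a x (theta : 'I_m -> R) (i : 'I_m) : R :=
  \sum_j theta j * invmx (gram a x) j i.

Lemma riesz_coordE a x theta k : atlas a -> dom a x ->
  g x (\sum_i riesz_coord a x theta i *: coord_vec a i x) (coord_vec a k x) = theta k.
Proof.
move=> aa ax; have tc i : tangent x (coord_vec a i x) by exact: coord_vec_tangent.
rewrite metric_suml //.
transitivity (((\row_j theta j) *m invmx (gram a x) *m gram a x) 0 k).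
  rewrite [RHS]mxE; apply: eq_bigr => i _; rewrite [in RHS]mxE [gram _ _ _ _]mxE.
  by congr (_ * _); apply: eq_bigr => j _; rewrite [in RHS]mxE.
by rewrite mulmxKV ?mxE //; exact: gram_unit.
Qed.

(** Supplies the witness that a [get] requires, both for [sharp] and for the horizontal lift. *)
Lemma riesz x (theta : ((M -> R) -> R) -> R) :
  (forall k u v, tangent x u -> tangent x v -> theta (k *: u + v) = k * theta u + theta v) ->
  exists2 h, tangent x h & forall u, tangent x u -> g x h u = theta u.
Proof.
move=> lin; have [a aa ax] := atlas_cover x.
pose h := \sum_i riesz_coord a x (fun j => theta (coord_vec a j x)) i *: coord_vec a i x.
have th : tangent x h by exact: lincomb_tangent.
have tc i : tangent x (coord_vec a i x) by exact: coord_vec_tangent.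
exists h => // u /(tangent_coord aa ax)[c ->]; rewrite metric_sumr //.
have theta0 : theta 0 = 0.
  have := lin 1 _ _ (tangent0 x) (tangent0 x).
  by rewrite scaler0 addr0 mul1r => E; apply/esym; apply: (addrI (theta 0)); rewrite -E addr0.
pose K u s := tangent x u /\ theta u = s.
suff : K (\sum_i c i *: coord_vec a i x) (\sum_i c i * g x h (coord_vec a i x)).
  by case.
apply: (big_rec2 K) => [|i s w _ [tw ws]]; first by split; [exact: tangent0|].
split; first exact: tangent_lin.
by rewrite lin // ws riesz_coordE.
Qed.

End Metric.

(** * Dependence on time *)

(** The shape of one summand of [act_act_coord]: [P] and [Q] are derivatives of a fixed function,
    while [p], [q], [r] come from moving coefficients. *)
Lemma is_derive_mul_lin (R : realType) (p q r : R -> R) (t p' q' r' P Q : R) :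
  is_derive t 1 p p' -> is_derive t 1 q q' -> is_derive t 1 r r' ->
  is_derive t 1 (fun s => p s * (q s * P + Q * r s))
    (p' * (q t * P + Q * r t) + p t * (q' * P + Q * r')).
Proof.
move=> dp dq dr.
have dqP := is_deriveM dq (is_derive_cst P t 1).
have dQr := is_deriveM (is_derive_cst Q t 1) dr.
apply: is_derive_eq (is_deriveM dp (is_deriveD dqP dQr)) _.
rewrite -![_ *: _]/(_ * _) -[(_ + _) t]/(q t * P + Q * r t) -[cst P t]/P -[cst Q t]/Q.
by ring.
Qed.

Lemma is_derive_mul_cst (R : realType) (p q : R -> R) (t p' q' P : R) :
  is_derive t 1 p p' -> is_derive t 1 q q' ->
  is_derive t 1 (fun s => p s * (q s * P)) (p' * (q t * P) + p t * (q' * P)).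
Proof.
move=> dp dq; have dqP := is_deriveM dq (is_derive_cst P t 1).
apply: is_derive_eq (is_deriveM dp dqP) _.
by rewrite -![_ *: _]/(_ * _) -[(_ * _) t]/(q t * P) -[cst P t]/P; ring.
Qed.

Section Time.
Context {R : realType} {m : nat} {M : manifold R m}.
Variable eps : R.
Implicit Types (a b : chart R m M) (F : R -> M -> R) (X Y : R -> field M) (f : M -> R).

Lemma near_time (t : R) : `|t| < eps -> \forall s \near t, `|s| < eps.
Proof.
move=> te; have : nbhs t (ball 0 eps).
  by apply: open_nbhs_nbhs; split; [exact: ball_open|rewrite /ball /= sub0r normrN].
by apply: filterS => s; rewrite /ball /= sub0r normrN.
Qed.

Definition time_dom a : set 'rV[R]_(1 + m) :=
  [set v : 'rV[R]_(1 + m) | `|lsubmx v 0 0| < eps /\ cod a (rsubmx v)].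

Definition time_local a F (v : 'rV[R]_(1 + m)) : R :=
  F (lsubmx v 0 0) (from a (rsubmx v)).

(** Time becomes the coordinate [lshift m 0] and space the coordinates [rshift 1 i], so time
    derivatives are partial derivatives of a function of 1 + m variables. *)
Definition time_pt (t : R) (u : 'rV[R]_m) : 'rV[R]_(1 + m) := row_mx (const_mx t) u.

Lemma time_ptl t u : lsubmx (time_pt t u) 0 0 = t.
Proof. by rewrite row_mxKl mxE. Qed.

Lemma time_ptr t u : rsubmx (time_pt t u) = u.
Proof. by rewrite row_mxKr. Qed.

Lemma time_local_pt a F (t : R) u : time_local a F (time_pt t u) = F t (from a u).
Proof. by rewrite /time_local time_ptl time_ptr. Qed.

Lemma time_pt_sub (v : 'rV[R]_(1 + m)) : time_pt (lsubmx v 0 0) (rsubmx v) = v.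
Proof.
rewrite -[RHS]hsubmxK; congr row_mx; apply/matrixP => i j.
by rewrite !ord1 mxE.
Qed.

Lemma time_dom_pt a t u : `|t| < eps -> cod a u -> time_dom a (time_pt t u).
Proof. by rewrite /time_dom /= time_ptl time_ptr. Qed.

Lemma lsubmx_coord (v : 'rV[R]_(1 + m)) : lsubmx v 0 0 = v 0 (lshift m 0).
Proof. by rewrite mxE. Qed.

Lemma rsubmx_continuous : continuous (fun v : 'rV[R]_(1 + m) => rsubmx v : 'rV[R]_m).
Proof.
move=> v; apply: (@cvg_rV _ _ _ (nbhs v)) => i.
under eq_fun do rewrite mxE.
by rewrite mxE; exact: coord_continuous.
Qed.

Lemma time_dom_open a : open (time_dom a).
Proof.
have -> : time_dom a =
    (setT `&` (fun v : 'rV[R]_(1 + m) => v 0 (lshift m 0)) @^-1` ball 0 eps) `&`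
    (fun v : 'rV[R]_(1 + m) => rsubmx v : 'rV[R]_m) @^-1` cod a.
  apply/seteqP; split => v; rewrite /time_dom /= lsubmx_coord.
    by move=> [te cv]; split=> //; split=> //; rewrite /ball /= sub0r normrN.
  by move=> [[_]]; rewrite /ball /= sub0r normrN.
apply: open_setI_preimage; [|exact: cod_open|by move=> u _; exact: rsubmx_continuous].
apply: open_setI_preimage; [exact: openT|exact: ball_open|].
by move=> u _; exact: coord_continuous.
Qed.

Lemma time_ptD t u (h : R) :
  h *: delta_mx 0 (lshift m 0) + time_pt t u = time_pt (h * 1 + t) u.
Proof.
apply/rowP => k; rewrite !mxE; case: (split_ordP k) => k' ->.
  by rewrite !mxE (inj_eq (@lshift_inj _ _)) !ord1 eqxx.
by rewrite eq_rlshift /= mulr0 add0r.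
Qed.

Lemma space_ptD t u (h : R) i :
  h *: delta_mx 0 (rshift 1 i) + time_pt t u = time_pt t (h *: delta_mx 0 i + u).
Proof.
apply/rowP => k; rewrite !mxE; case: (split_ordP k) => k' ->.
  by rewrite !mxE eq_lrshift /= mulr0 add0r.
by rewrite !mxE (inj_eq (@rshift_inj _ _)).
Qed.

Lemma time_is_derive (H : 'rV[R]_(1 + m) -> R) t u d :
  is_derive (time_pt t u) (delta_mx 0 (lshift m 0)) H d ->
  is_derive t 1 (fun s => H (time_pt s u)) d.
Proof. by apply: is_derive_along => h; rewrite time_ptD. Qed.

Lemma space_is_derive (H : 'rV[R]_(1 + m) -> R) t u i d :
  is_derive (time_pt t u) (delta_mx 0 (rshift 1 i)) H d ->
  is_derive u (delta_mx 0 i) (fun v => H (time_pt t v)) d.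
Proof. by apply: is_derive_along => h; rewrite space_ptD. Qed.

Lemma time_smooth_is_derive a F (t : R) u : time_smooth eps a F -> `|t| < eps -> cod a u ->
  is_derive t 1 (fun s => F s (from a u))
    (partial (lshift m 0) (time_local a F) (time_pt t u)).
Proof.
move=> sF te au; have := Cinf_is_derive (lshift m 0) sF (time_dom_pt te au).
by move=> /time_is_derive; congr is_derive; apply/funext => s; exact: time_local_pt.
Qed.

Lemma time_smooth_partial a F (t : R) u i : time_smooth eps a F -> `|t| < eps -> cod a u ->
  partial i (F t \o from a) u = partial (rshift 1 i) (time_local a F) (time_pt t u).
Proof.
move=> sF te au; have := Cinf_is_derive (rshift 1 i) sF (time_dom_pt te au).
move=> /space_is_derive [_ <-]; rewrite /partial.
congr (derive _ u (delta_mx 0 i)); apply/funext => v.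
by rewrite [RHS]time_local_pt.
Qed.

Lemma time_smooth_at a F t : time_smooth eps a F -> `|t| < eps ->
  Cinf (cod a) (F t \o from a).
Proof.
move=> sF te; apply: (eq_Cinf (f := fun u => time_local a F (time_pt t u))).
- exact: cod_open.
- by move=> u _; exact: time_local_pt.
apply: (@Cinf_comp _ _ _ (cod a) (time_dom a) (time_pt t) (time_local a F)) => //.
- exact: cod_open.
- exact: time_dom_open.
- by move=> u; exact: time_dom_pt.
move=> l.
have oa := @cod_open _ _ _ a.
case: (split_ordP l) => k ->.
  by apply: (eq_Cinf (f := fun=> t)) => // [u _|]; [rewrite /time_pt row_mxEl mxE|exact: Cinf_cst].
apply: (eq_Cinf (f := fun u : 'rV[R]_m => u 0 k)) => // [u _|].
  by rewrite row_mxEr.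
exact: Cinf_coord.
Qed.

Definition dt F (t : R) : M -> R := fun x => derive1 (fun s => F s x) t.

Lemma time_smooth_is_derive_dt a F (t : R) x : time_smooth eps a F -> `|t| < eps -> dom a x ->
  is_derive t 1 (fun s => F s x) (dt F t x).
Proof.
move=> sF te ax; have := time_smooth_is_derive sF te (to_cod ax).
by rewrite toK // => -[dF _]; rewrite /dt derive1E; exact: derivableP.
Qed.

Lemma time_smooth_dt a F : time_smooth eps a F -> time_smooth eps a (dt F).
Proof.
move=> sF; have := Cinf_partial (lshift m 0) sF; apply: eq_Cinf.
  exact: time_dom_open.
move=> v [te au]; rewrite /dt derive1E.
have [_ ->] := time_smooth_is_derive sF te au.
by rewrite time_pt_sub.
Qed.

(** Time and space derivatives commute by [partialC] on the joint domain; this is where smoothness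
    in all variables together enters. *)
Lemma time_smooth_partial_dt a F (t : R) u i : time_smooth eps a F -> `|t| < eps -> cod a u ->
  is_derive t 1 (fun s => partial i (F s \o from a) u) (partial i (dt F t \o from a) u).
Proof.
move=> sF te au.
have D := Cinf_is_derive (lshift m 0) (Cinf_partial (rshift 1 i) sF) (time_dom_pt te au).
move: D => /time_is_derive.
have -> : partial (lshift m 0) (partial (rshift 1 i) (time_local a F)) (time_pt t u) =
    partial i (dt F t \o from a) u.
  apply: etrans (esym (time_smooth_partial i (time_smooth_dt sF) te au)).
  have C := partialC (lshift m 0) (rshift 1 i) (@time_dom_open a) (sF 2%N) (time_dom_pt te au).
  apply: etrans C _.
  apply: near_eq_derive; apply: (@open_near _ _ (time_dom a)).
  - exact: time_dom_open.
  - exact: time_dom_pt.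
  move=> v [ve av].
  rewrite -[v]time_pt_sub time_local_pt /dt derive1E.
  by have [_ ->] := time_smooth_is_derive sF ve av.
apply: near_eq_is_derive.
have := near_time te; apply: filterS => s se.
exact/esym/time_smooth_partial.
Qed.

Lemma time_smooth_field_at X t : time_smooth_field eps X -> `|t| < eps ->
  smooth_field (X t).
Proof.
move=> sX te a aa; have [c sc cE] := sX a aa; exists (fun i => c i t).
  by move=> i; exact: time_smooth_at.
by move=> x; exact: cE.
Qed.

Lemma time_smooth_field_is_derive X (t : R) x f : time_smooth_field eps X -> `|t| < eps ->
  is_derive t 1 (fun s => X s x f) (dt_field X t x f).
Proof.
move=> sX te; have [a aa ax] := atlas_cover x; have [c sc cE] := sX a aa.
have D i := time_smooth_is_derive_dt (sc i) te ax.
have [dX _] : is_derive t 1 (fun s => X s x f) (\sum_i dt (c i) t x * coord_vec a i x f).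
  apply: (near_eq_is_derive (f := \sum_i (fun s => c i s x * coord_vec a i x f))).
    have := near_time te; apply: filterS => s se.
    by rewrite cE // fct_lincombE fct_sumE.
  apply: is_derive_sum => i.
  apply: is_derive_eq (is_deriveM (D i) (is_derive_cst (coord_vec a i x f) t 1)) _.
  by rewrite -![_ *: _]/(_ * _) mulr0 add0r mulrC.
by rewrite /dt_field derive1E; exact: derivableP.
Qed.

Lemma dt_field_coord X t x a (c : 'I_m -> R -> M -> R) : `|t| < eps -> dom a x ->
  (forall i, time_smooth eps a (c i)) ->
  (forall s y, `|s| < eps -> dom a y -> X s y = \sum_i c i s y *: coord_vec a i y) ->
  dt_field X t x = \sum_i dt (c i) t x *: coord_vec a i x.
Proof.
move=> te ax sc cE; apply/funext => f; rewrite fct_lincombE /dt_field derive1E.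
have D i := time_smooth_is_derive_dt (sc i) te ax.
have [_ //] : is_derive t 1 (fun s => X s x f) (\sum_i dt (c i) t x * coord_vec a i x f).
apply: (near_eq_is_derive (f := \sum_i (fun s => c i s x * coord_vec a i x f))).
  have := near_time te; apply: filterS => s se.
  by rewrite cE // fct_lincombE fct_sumE.
apply: is_derive_sum => i.
apply: is_derive_eq (is_deriveM (D i) (is_derive_cst (coord_vec a i x f) t 1)) _.
by rewrite -![_ *: _]/(_ * _) mulr0 add0r mulrC.
Qed.

Lemma time_smooth_dt_field X : time_smooth_field eps X ->
  time_smooth_field eps (dt_field X).
Proof.
move=> sX a aa; have [c sc cE] := sX a aa; exists (fun i => dt (c i)).
  by move=> i; exact: time_smooth_dt.
by move=> t x te ax; exact: dt_field_coord.
Qed.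

Lemma act_act_is_derive X Y (t : R) x f : time_smooth_field eps X ->
  time_smooth_field eps Y -> `|t| < eps -> smooth_fun f ->
  is_derive t 1 (fun s => X s x (act (Y s) f))
    (dt_field X t x (act (Y t) f) + X t x (act (dt_field Y t) f)).
Proof.
move=> sX sY te sf; have [a aa ax] := atlas_cover x.
have [c sc cE] := sX a aa; have [d sd dE] := sY a aa.
have au := to_cod ax; rewrite -[x](toK ax).
set u := to a x in au *.
pose P i j := partial i (partial j (f \o from a)) u.
pose Q j := partial j (f \o from a) u.
pose p i (s : R) := c i s (from a u); pose q j (s : R) := d j s (from a u).
pose r i j (s : R) := partial i (d j s \o from a) u.
pose T (s : R) := \sum_i \sum_j p i s * (q j s * P i j + Q j * r i j s).
have E s : `|s| < eps -> X s (from a u) (act (Y s) f) = T s.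
  move=> se; apply: (@act_act_coord _ _ _ a (X s) (Y s) (fun i => c i s) (fun j => d j s)) => //.
  - exact: time_smooth_field_at.
  - by move=> y; exact: cE.
  - by move=> y; exact: dE.
  - by move=> i; exact: time_smooth_at.
have oa := @cod_open _ _ _ a.
rewrite (@act_act_coord _ _ _ a (dt_field X t) (Y t) (fun i => dt (c i) t) (fun i => d i t)) //; first last.
- by move=> i; exact: time_smooth_at.
- by move=> y; exact: dE.
- by move=> y ay; exact: dt_field_coord.
- exact: time_smooth_field_at.
rewrite (@act_act_coord _ _ _ a (X t) (dt_field Y t) (fun i => c i t) (fun i => dt (d i) t)) //; first last.
- by move=> i; apply: time_smooth_at => //; exact: time_smooth_dt.
- by move=> y ay; exact: dt_field_coord.
- by move=> y; exact: cE.
- apply: time_smooth_field_at => //; exact: time_smooth_dt_field.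
apply: (near_eq_is_derive (f := \sum_i \sum_j (fun s : R =>
   p i s * (q j s * P i j + Q j * r i j s)))).
  have := near_time te; apply: filterS => s se.
  rewrite E // /T fct_sumE; apply: eq_bigr => i _.
  by rewrite fct_sumE.
rewrite -big_split /=.
apply: is_derive_sum => i; rewrite -big_split /=.
apply: is_derive_sum => j.
have ay : dom a (from a u) by exact: from_dom.
have dp := time_smooth_is_derive_dt (sc i) te ay.
have dq := time_smooth_is_derive_dt (sd j) te ay.
have dr := time_smooth_partial_dt i (sd j) te au.
exact: is_derive_mul_lin dp dq dr.
Qed.

(** The Leibniz rule in time. For [f] not smooth all brackets vanish at [f], so the identity holds
    on every functional argument. *)
Lemma bracket_is_derive X Y (t : R) x f : time_smooth_field eps X ->
  time_smooth_field eps Y -> `|t| < eps ->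
  is_derive t 1 (fun s => bracket (X s) (Y s) x f)
    ((bracket (dt_field X t) (Y t) + bracket (X t) (dt_field Y t)) x f).
Proof.
move=> sX sY te; have [sf|sf] := pselect (smooth_fun f); last first.
  have sd := time_smooth_field_at (time_smooth_dt_field sX) te.
  have sd' := time_smooth_field_at (time_smooth_dt_field sY) te.
  rewrite -[(_ + _) x f]/(bracket _ _ x f + bracket _ _ x f).
  rewrite !(bracket_nonsmooth _ _ _ sf) ?addr0 //; try exact: time_smooth_field_at.
  apply: (near_eq_is_derive (f := cst 0)).
  have := near_time te; apply: filterS => s se.
  by rewrite bracket_nonsmooth //; exact: time_smooth_field_at.
apply: is_derive_eq (is_deriveB (act_act_is_derive x sX sY te sf)
  (act_act_is_derive x sY sX te sf)) _.
rewrite -[RHS]/(bracket _ _ x f + bracket _ _ x f) /bracket.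
by rewrite opprD (addrC (- dt_field Y t x _)) !addrA; congr (_ + _); rewrite -!addrA; congr (_ + _); exact: addrC.
Qed.

End Time.

(** * Riemannian submersions *)

Section Push.
Context {R : realType} {m p : nat} {M : manifold R m} {N : manifold R p}.
Variable pi : M -> N.
Hypothesis spi : smooth_map pi.
Implicit Types (a : chart R m M) (b : chart R p N) (X Y : field M) (U V : field N).

Definition local_dom a b : set 'rV[R]_m := cod a `&` (pi \o from a) @^-1` dom b.

Lemma local_dom_open a b : open (local_dom a b).
Proof.
apply: open_setI_preimage; [exact: cod_open|exact: dom_open|].
move=> u au; apply: continuous_comp; first exact: from_continuous.
by case: spi => + _; exact.
Qed.

Lemma Cinf_local_map a b (f : 'rV[R]_p -> R) : atlas a -> atlas b -> Cinf (cod b) f ->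
  Cinf (local_dom a b) (fun u => f (to b (pi (from a u)))).
Proof.
move=> aa ab Cf.
apply: (@Cinf_comp _ _ _ (local_dom a b) (cod b) (fun u => to b (pi (from a u))) f) => //.
- exact: local_dom_open.
- exact: cod_open.
- by move=> u [_]; exact: to_cod.
- by case: spi => _; exact.
Qed.

Lemma smooth_comp (f : N -> R) : smooth_fun f -> smooth_fun (f \o pi).
Proof.
move=> sf a aa; apply: Cinf_local => u au.
have [b ab bu] := atlas_cover (pi (from a u)).
exists (local_dom a b); split=> //; first exact: local_dom_open.
apply: (eq_Cinf (f := fun v => (f \o from b) (to b (pi (from a v))))).
- exact: local_dom_open.
- by move=> v [_ bv] /=; rewrite toK.
- by apply: Cinf_local_map => //; exact: sf.
Qed.

Lemma pushE v (f : N -> R) : smooth_fun f -> push pi v f = v (f \o pi).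
Proof. by move=> sf; rewrite /push /on_smooth asboolT. Qed.

Lemma push_nonsmooth v (f : N -> R) : ~ smooth_fun f -> push pi v f = 0.
Proof. by move=> sf; rewrite /push /on_smooth asboolF. Qed.

Lemma push_lin k v w : push pi (k *: v + w) = k *: push pi v + push pi w.
Proof.
apply/funext => f; rewrite -[RHS]/(k * push pi v f + push pi w f).
have [sf|sf] := pselect (smooth_fun f); first by rewrite !pushE.
by rewrite !push_nonsmooth // mulr0 addr0.
Qed.

Lemma push0 : push pi 0 = 0.
Proof.
apply/funext => f; have [sf|sf] := pselect (smooth_fun f); first by rewrite pushE.
by rewrite push_nonsmooth.
Qed.

Lemma pushD v w : push pi (v + w) = push pi v + push pi w.
Proof. by rewrite -{1}[v]scale1r push_lin scale1r. Qed.

Lemma pushZ k v : push pi (k *: v) = k *: push pi v.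
Proof. by rewrite -[k *: v]addr0 push_lin push0 addr0. Qed.

Lemma pushB v w : push pi (v - w) = push pi v - push pi w.
Proof. by rewrite -scaleN1r pushD pushZ scaleN1r. Qed.

Lemma push_coord a b j x : atlas a -> atlas b -> dom a x -> dom b (pi x) ->
  push pi (coord_vec a j x) =
  \sum_l partial j (fun u => to b (pi (from a u)) 0 l) (to a x) *: coord_vec b l (pi x).
Proof.
move=> aa ab ax bx; apply/funext => f; rewrite fct_lincombE.
have [sf|sf] := pselect (smooth_fun f); last first.
  rewrite push_nonsmooth // big1 // => l _.
  by rewrite (tangent_vanish (coord_vec_tangent l ab bx) sf) mulr0.
under eq_bigr do rewrite coord_vecE //.
rewrite pushE // coord_vecE; last exact: smooth_comp.
have xab : local_dom a b (to a x) by split; [exact: to_cod|rewrite /= toK].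
have E : {near to a x, (fun u => (f \o from b) (to b (pi (from a u)))) =1 (f \o pi) \o from a}.
  apply: (@open_near _ _ (local_dom a b)) => //; first exact: local_dom_open.
  by move=> u [_ bu] /=; rewrite toK.
have bxb : cod b (to b (pi (from a (to a x)))) by rewrite toK //; exact: to_cod.
have Cphi l : Cinf (local_dom a b) (fun u => to b (pi (from a u)) 0 l).
  by case: spi => _; exact.
have [_] := @Ck_is_derive_comp R _ p 0 (cod b) (f \o from b)
  (fun u => to b (pi (from a u))) (to a x) (delta_mx 0 j)
  (fun l => partial j (fun u => to b (pi (from a u)) 0 l) (to a x))
  (@cod_open _ _ _ b) (sf b ab 1%N) bxb
  (fun l => Cinf_is_derive j (Cphi l) xab).
by rewrite (near_eq_derive _ E) [from a (to a x)]toK.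
Qed.

Lemma push_tangent x v : tangent x v -> tangent (pi x) (push pi v).
Proof.
have [a aa ax] := atlas_cover x; have [b ab bx] := atlas_cover (pi x).
move=> /(tangent_coord aa ax)[c ->].
pose K v := tangent (pi x) (push pi v).
apply: (big_ind K); rewrite /K.
- by rewrite push0; exact: tangent0.
- by move=> u w tu tw; rewrite pushD; exact: tangentD.
move=> i _; rewrite pushZ; apply: tangentZ.
by rewrite (push_coord i aa ab ax bx); exact: lincomb_tangent.
Qed.

(** The usual relation of fields under a map. It passes to brackets, which is why horizontal parts
    of brackets of lifts are governed by the base. *)
Definition related (X : field M) (U : field N) := forall x, push pi (X x) = U (pi x).

Lemma related_act X U (f : N -> R) x : related X U -> smooth_fun f ->
  act X (f \o pi) x = act U f (pi x).
Proof. by move=> XX sf; rewrite /act -XX pushE. Qed.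

Lemma related_bracket X U Y V : smooth_field U -> smooth_field V ->
  related X U -> related Y V -> related (bracket X Y) (bracket U V).
Proof.
move=> sX sY XX YY x; apply/funext => f.
have [sf|sf] := pselect (smooth_fun f); last first.
  by rewrite push_nonsmooth // bracket_nonsmooth.
rewrite pushE // /bracket.
have -> : act Y (f \o pi) = act V f \o pi by apply/funext => y; exact: related_act.
have -> : act X (f \o pi) = act U f \o pi by apply/funext => y; exact: related_act.
have E1 := related_act x XX (smooth_act sY sf).
have E2 := related_act x YY (smooth_act sX sf).
by move: E1 E2; rewrite /act => -> ->.
Qed.

Lemma bracket0l V : smooth_field V -> bracket (0 : field N) V = 0.
Proof.
move=> sY; apply/funext => y; apply/funext => f; rewrite /bracket.
rewrite -[act 0 f]/(fun=> 0) (tangent_cst 0 (smooth_field_tangent y sY)) subr0.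
by [].
Qed.

Lemma bracket0r U : smooth_field U -> bracket U (0 : field N) = 0.
Proof.
move=> sX; apply/funext => y; apply/funext => f; rewrite /bracket.
rewrite -[act 0 f]/(fun=> 0) (tangent_cst 0 (smooth_field_tangent y sX)) sub0r.
exact: oppr0.
Qed.

Lemma tangent_to_vertical X : tangent_to (vertical pi) X <-> smooth_field X /\ related X 0.
Proof.
split=> -[sX vX]; split=> // x; first by have [] := vX x.
by split; [exact: smooth_field_tangent|exact: vX].
Qed.

(** A vertical field is related to 0, so its bracket with a projectable field is related to the
    bracket of 0 with [V], which is 0. *)
Lemma vertical_bracketl X Y V : tangent_to (vertical pi) X -> smooth_field Y ->
  smooth_field V -> related Y V -> tangent_to (vertical pi) (bracket X Y).
Proof.
move=> /tangent_to_vertical [sX X0] sY sV YY; apply/tangent_to_vertical.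
split; first exact: smooth_bracket.
by rewrite -(bracket0l sV); apply: related_bracket => //; exact: smooth_field0.
Qed.

Lemma vertical_bracketr X Y V : tangent_to (vertical pi) X -> smooth_field Y ->
  smooth_field V -> related Y V -> tangent_to (vertical pi) (bracket Y X).
Proof.
move=> /tangent_to_vertical [sX X0] sY sV YY; apply/tangent_to_vertical.
split; first exact: smooth_bracket.
by rewrite -(bracket0r sV); apply: related_bracket => //; exact: smooth_field0.
Qed.

Lemma verticalD x v w : vertical pi x v -> vertical pi x w -> vertical pi x (v + w).
Proof.
by move=> [tv v0] [tw w0]; split; [exact: tangentD|rewrite pushD v0 w0 addr0].
Qed.

Lemma verticalZ x (k : R) v : vertical pi x v -> vertical pi x (k *: v).
Proof. by move=> [tv v0]; split; [exact: tangentZ|rewrite pushZ v0 scaler0]. Qed.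

Lemma tangent_to_verticalD X Y : tangent_to (vertical pi) X ->
  tangent_to (vertical pi) Y -> tangent_to (vertical pi) (X + Y).
Proof.
move=> [sX vX] [sY vY]; split; first exact: smooth_fieldD.
by move=> x; exact: verticalD.
Qed.

Lemma tangent_to_verticalM (f : M -> R) X : smooth_fun f -> tangent_to (vertical pi) X ->
  tangent_to (vertical pi) (fun x => f x *: X x).
Proof.
move=> sf [sX vX]; split; first exact: smooth_fieldM.
by move=> x; exact: verticalZ.
Qed.

Lemma tangent_to_vertical_sum (I : Type) (r : seq I) (P : pred I) (F : I -> field M) :
  (forall i, P i -> tangent_to (vertical pi) (F i)) ->
  tangent_to (vertical pi) (\sum_(i <- r | P i) F i).
Proof.
move=> H; apply: big_ind => //; last exact: tangent_to_verticalD.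
by apply/tangent_to_vertical; split; [exact: smooth_field0|move=> x; exact: push0].
Qed.

Section PullbackForm.
Variables (gN : tensor2 N) (W : field N).
Hypotheses (gNM : riem_metric gN) (sW : smooth_field W).

Lemma Cinf_metric_coord_vec b l : atlas b ->
  Cinf (cod b) (fun u => gN (from b u) (W (from b u)) (coord_vec b l (from b u))).
Proof.
move=> ab; have [c sc cE] := sW ab; have ob := @cod_open _ _ _ b.
apply: (eq_Cinf (f := fun u : 'rV[R]_p => \sum_r c r (from b u) * component gN b r l (from b u))).
- by [].
- move=> u /from_dom bu; rewrite cE // metric_suml // => [r _|].
    exact: coord_vec_tangent.
  exact: coord_vec_tangent.
apply: Cinf_sum => // r _; apply: Cinf_mul => //; first exact: sc.
by case: gNM => _ _ _; exact.
Qed.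

(** These are the components of the covector whose dual under [g t] is the lift of [W]; they involve
    neither the metric on [M] nor time. *)
Lemma Cinf_pullback_form a j : atlas a ->
  Cinf (cod a) (fun u => gN (pi (from a u)) (W (pi (from a u)))
                            (push pi (coord_vec a j (from a u)))).
Proof.
move=> aa; apply: Cinf_local => u au.
have [b ab bu] := atlas_cover (pi (from a u)).
have ol := @local_dom_open a b.
exists (local_dom a b); split=> //.
pose h l (u : 'rV[R]_p) := gN (from b u) (W (from b u)) (coord_vec b l (from b u)).
apply: (eq_Cinf (f := fun v => \sum_l partial j (fun u => to b (pi (from a u)) 0 l) v *
   h l (to b (pi (from a v))))) => //.
- move=> v [av /= bv].
  rewrite (push_coord j aa ab (from_dom av) bv) fromK //.
  rewrite metric_sumr //.
  + by apply: eq_bigr => l _; rewrite /h toK.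
  + by move=> l _; exact: coord_vec_tangent.
  + exact: smooth_field_tangent.
apply: Cinf_sum => // l _; apply: Cinf_mul => //.
  by apply: Cinf_partial; case: spi => _; exact.
by apply: Cinf_local_map => //; exact: Cinf_metric_coord_vec.
Qed.

End PullbackForm.

End Push.

(** * Orthonormal frames on the base *)

Section Frame.
Context {R : realType} {p : nat} {N : manifold R p}.
Variables (gN : tensor2 N) (W : 'I_p -> field N).
Hypotheses (gNM : riem_metric gN) (sW : forall k, smooth_field (W k)).
Hypothesis oW : forall y i j, eval2 gN (W i) (W j) y = (i == j)%:R.

Lemma frame_tangent k y : tangent y (W k y).
Proof. exact: smooth_field_tangent. Qed.

Lemma frame_lincomb (c : 'I_p -> R) k y :
  gN y (\sum_i c i *: W i y) (W k y) = c k.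
Proof.
rewrite (metric_suml gNM) => [|i _|]; try exact: frame_tangent.
rewrite (bigD1 k) //= [gN _ _ _]oW eqxx mulr1 big1 ?addr0 // => i ik.
by rewrite [gN _ _ _]oW (negbTE ik) mulr0.
Qed.

(** There are as many fields as dimensions: orthonormality reads A G A^T = 1 for the square matrix A
    of the frame in coordinates, which forces A to be invertible, so the frame spans. *)
Lemma frame_expand y w : tangent y w -> w = \sum_k gN y w (W k y) *: W k y.
Proof.
have [b ab bx] := atlas_cover y => tw.
have /choice [A AE] k : exists c, W k y = \sum_l c l *: coord_vec b l y.
  exact: tangent_coord (frame_tangent k y).
pose Am : 'M[R]_p := \matrix_(k, l) A k l.
have uA : Am \in unitmx.
  have /mulmx1_unit [] // : Am *m (gram gN b y *m Am^T) = 1%:M.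
  apply/matrixP => i j; rewrite !mxE -(oW y) /eval2 !AE metric_coord //.
  apply: eq_bigr => k _; rewrite !mxE mulr_sumr; apply: eq_bigr => l _.
  by rewrite !mxE mulrAC mulrA.
have [c cE] := tangent_coord ab bx tw.
have E : w = \sum_k ((\row_l c l) *m invmx Am) 0 k *: W k y.
  transitivity (\sum_l ((\row_l c l) *m invmx Am *m Am) 0 l *: coord_vec b l y).
    by rewrite mulmxKV // cE; apply: eq_bigr => l _; rewrite mxE.
  under [RHS]eq_bigr do rewrite AE scaler_sumr.
  rewrite [RHS]exchange_big /=; apply: eq_bigr => l _.
  rewrite mxE scaler_suml; apply: eq_bigr => k _.
  by rewrite scalerA [Am k l]mxE.
by rewrite E; apply: eq_bigr => k _; rewrite frame_lincomb.
Qed.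

Lemma frame_metric y v w : tangent y v -> tangent y w ->
  gN y v w = \sum_k gN y v (W k y) * gN y w (W k y).
Proof.
move=> tv tw; rewrite {1}(frame_expand tw) (metric_sumr gNM) //.
  by apply: eq_bigr => k _; rewrite mulrC.
by move=> k _; exact: frame_tangent.
Qed.

End Frame.

(** * Existence and uniqueness of horizontal lifts and projections *)

Section HorizontalLift.
Context {R : realType} {m p : nat} {M : manifold R m} {N : manifold R p}.
Variables (pi : M -> N) (gN : tensor2 N) (W : 'I_p -> field N).
Hypotheses (gNM : riem_metric gN) (sW : forall k, smooth_field (W k)).
Hypothesis oW : forall y i j, eval2 gN (W i) (W j) y = (i == j)%:R.
Variable g : tensor2 M.
Hypotheses (gM : riem_metric g) (sub : riem_submersion pi g gN).
Let VV := vertical pi.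

Let spi : smooth_map pi. Proof. by case: sub. Qed.

Lemma vertical_orth_eq0 x u : VV x u -> orth g VV x u -> u = 0.
Proof. by move=> vu [tu ou]; apply: (metric_eq0 gM) tu _; exact: ou. Qed.

Lemma orthB x u v : orth g VV x u -> orth g VV x v -> orth g VV x (u - v).
Proof.
move=> [tu ou] [tv ov]; split=> [|w Vw]; first exact: tangentB.
by rewrite (metricBl gM) ?ou ?ov ?subrr //; case: Vw.
Qed.

Lemma verticalB x u v : VV x u -> VV x v -> VV x (u - v).
Proof.
by move=> [tu u0] [tv v0]; split; [exact: tangentB|rewrite pushB u0 v0 subrr].
Qed.

(** The rank condition gives p independent vectors in the image; their matrix in the orthonormal
    frame is square with trivial kernel, hence invertible. *)
Lemma push_onto x w : tangent (pi x) w -> exists2 v, tangent x v & push pi v = w.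
Proof.
case: sub => _ /(_ x)[b [bv bfree _]] _ tw.
have /choice [v vE] i : exists v, tangent x v /\ push pi v = b i.
  by have [v tv vb] := bv i; exists v.
have tb i : tangent (pi x) (b i) by have [tv <-] := vE i; exact: push_tangent.
pose B : 'M[R]_p := \matrix_(i, k) gN (pi x) (b i) (W k (pi x)).
have uB : B \in unitmx.
  rewrite unitmxE unitfE; apply/det0P => -[c c0 cB].
  have /bfree c0' : \sum_i c 0 i *: b i = 0.
    have tcb : tangent (pi x) (\sum_i c 0 i *: b i).
      by apply: tangent_sum => i _; exact: tangentZ.
    rewrite (frame_expand gNM sW oW tcb) big1 // => k _; rewrite (metric_suml gNM) //; last exact: frame_tangent.
    suff -> : \sum_i c 0 i * gN (pi x) (b i) (W k (pi x)) = (c *m B) 0 k.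
      by rewrite cB mxE scale0r.
    by rewrite mxE; apply: eq_bigr => i _; rewrite mxE.
  by move/eqP: c0; apply; apply/rowP => i; rewrite c0' mxE.
pose c := (\row_k gN (pi x) w (W k (pi x))) *m invmx B.
exists (\sum_i c 0 i *: v i).
  by apply: tangent_sum => i _; apply: tangentZ; have [] := vE i.
have psum : push pi (\sum_i c 0 i *: v i) = \sum_i c 0 i *: b i.
  apply: (big_ind2 (fun u w => push pi u = w)) => [|u u' s s' <- <-|i _].
  - exact: push0.
  - exact: pushD.
  - by rewrite pushZ; have [_ ->] := vE i.
rewrite psum [RHS](frame_expand gNM sW oW tw).
under eq_bigr do rewrite (frame_expand gNM sW oW (tb _)) scaler_sumr.
rewrite exchange_big /=; apply: eq_bigr => k _.
under eq_bigr do rewrite scalerA; rewrite -scaler_suml; congr (_ *: _).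
transitivity ((c *m B) 0 k); last by rewrite mulmxKV // mxE.
by rewrite mxE; apply: eq_bigr => i _; rewrite [B i k]mxE.
Qed.

(* The vector [h k] dual to [gN (W_k, pi_* u)] is horizontal, and the matrix
   [P] of the [pi_* (h k)] in the frame [W] is both the Gram matrix of the [h k]
   and equal to [P P^T].  Hence [P] is an invertible projector, so it is 1. *)
Lemma hlift_exists x k : exists h, [/\ orth g VV x h, push pi h = W k (pi x) &
  forall u, tangent x u -> g x h u = gN (pi x) (W k (pi x)) (push pi u)].
Proof.
have tW l : tangent (pi x) (W l (pi x)) by exact: frame_tangent.
have tp u : tangent x u -> tangent (pi x) (push pi u) by exact: push_tangent.
have /choice [h hE] l : exists h, tangent x h /\
    forall u, tangent x u -> g x h u = gN (pi x) (W l (pi x)) (push pi u).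
  have [|h th hE] := @riesz _ _ _ _ gM x (fun u => gN (pi x) (W l (pi x)) (push pi u)).
    move=> c u v tu tv; rewrite push_lin (metricDr gNM) ?(metricZr gNM) //;
    by [apply: tp|apply: tangentZ; exact: tp].
  by exists h.
have th l : tangent x (h l) by have [] := hE l.
have gh l u : tangent x u -> g x (h l) u = gN (pi x) (W l (pi x)) (push pi u).
  by move=> tu; have [_ ->] := hE l.
have oh l : orth g VV x (h l).
  by split=> // v [tv v0]; rewrite gh // v0 (metricC gNM) ?(metric0l gNM) //; exact: tangent0.
pose P : 'M[R]_p := \matrix_(l, r) gN (pi x) (push pi (h l)) (W r (pi x)).
have PE l r : P l r = g x (h r) (h l).
  by rewrite mxE gh // (metricC gNM) //; exact: tp.
have PT : P^T = P by apply/matrixP => l r; rewrite mxE !PE (metricC gM).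
(* The submersion condition, applied to the horizontal vectors [h l] and [h r], replaces their inner
   product by that of their push-forwards. *)
have PP : P *m P = P.
  rewrite -{2}PT; apply/matrixP => l r.
  rewrite [RHS]PE (metricC gM) //; case: sub => _ _ ->; [|exact: oh|exact: oh].
  rewrite (frame_metric gNM sW oW) //; [|exact: tp|exact: tp].
  by rewrite mxE; apply: eq_bigr => s _; rewrite !mxE.
(* A null row vector gives a combination of the [h l] of length zero; pairing it with a preimage of
   each [W k'] reads off its coefficients. *)
have uP : P \in unitmx.
  rewrite unitmxE unitfE; apply/det0P => -[c c0 cP].
  have hc0 : \sum_l c 0 l *: h l = 0.
    apply: (metric_eq0 gM (x := x)).
      by apply: tangent_sum => l _; exact: tangentZ.
    rewrite (metric_suml gM) //; last by apply: tangent_sum => l _; exact: tangentZ.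
    rewrite big1 // => l _; rewrite (metric_sumr gM) //.
    suff -> : \sum_s c 0 s * g x (h l) (h s) = (c *m P) 0 l by rewrite cP mxE mulr0.
    by rewrite mxE; apply: eq_bigr => s _; rewrite PE.
  have [v tv vE] : exists2 v, tangent x v & push pi v = \sum_l c 0 l *: W l (pi x).
    by apply: push_onto; apply: tangent_sum => l _; exact: tangentZ.
  move/eqP: c0; apply; apply/rowP => k'; rewrite mxE.
  have [v' tv' v'E] := push_onto (tW k').
  have : g x (\sum_l c 0 l *: h l) v' = 0 by rewrite hc0 (metric0l gM).
  rewrite (metric_suml gM) // => <-.
  under eq_bigr do rewrite gh // v'E.
  by rewrite -(metric_suml gNM) // (frame_lincomb gNM sW oW).
have P1 : P = 1%:M by rewrite -[P](mulKmx uP) PP mulVmx.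
exists (h k); split=> //; last exact: gh.
rewrite (frame_expand gNM sW oW (tp _ (th k))).
rewrite (bigD1 k) //= big1 ?addr0 => [|l lk].
  by have := PE k k; rewrite -PE P1 !mxE eqxx; have := congr1 (fun A : 'M[R]_p => A k k) P1;
    rewrite !mxE eqxx => -> _; rewrite scale1r.
have := congr1 (fun A : 'M[R]_p => A k l) P1; rewrite !mxE => ->.
by rewrite eq_sym (negbTE lk) scale0r.
Qed.

Lemma orth_push_inj x u v : orth g VV x u -> orth g VV x v ->
  push pi u = push pi v -> u = v.
Proof.
move=> ou ov uv; apply/eqP; rewrite -subr_eq0; apply/eqP.
apply: (@vertical_orth_eq0 x); last exact: orthB.
by case: ou ov => tu _ [tv _]; split; [exact: tangentB|rewrite pushB uv subrr].
Qed.

Lemma hlift_spec x k : orth g VV x (hlift pi g (W k) x) /\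
  push pi (hlift pi g (W k) x) = W k (pi x).
Proof.
have [h [oh ph _]] := hlift_exists x k.
by apply: (@getPex _ [set u | orth g VV x u /\ push pi u = W k (pi x)]); exists h.
Qed.

(** Subtracting a vertical vector does not change the push-forward, so the projection of any vector
    over [W k] is the lift of [W k]. It is applied to the lift for [g 0] projected with respect to
    [g t]. *)
Lemma proj_H_spec (X : field M) x k : tangent x (X x) -> push pi (X x) = W k (pi x) ->
  [/\ orth g VV x (proj_H g VV X x), push pi (proj_H g VV X x) = W k (pi x) &
   forall u, tangent x u ->
     g x (proj_H g VV X x) u = gN (pi x) (W k (pi x)) (push pi u)].
Proof.
move=> tX pX; have [h [oh ph gh]] := hlift_exists x k.
have th : tangent x h by case: oh.
have [oH vH] : orth g VV x (proj_H g VV X x) /\ VV x (X x - proj_H g VV X x).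
  apply: (@getPex _ [set u | orth g VV x u /\ VV x (X x - u)]); exists h => /=.
  by split=> //; split; [exact: tangentB|rewrite pushB pX ph subrr].
have pH : push pi (proj_H g VV X x) = W k (pi x).
  by case: vH => _; rewrite pushB pX => /eqP; rewrite subr_eq0 => /eqP.
split=> // u tu; rewrite -gh //; congr g.
by apply: (orth_push_inj oH oh); rewrite pH ph.
Qed.

Lemma proj_V_eq (X : field M) x u : VV x u -> orth g VV x (X x - u) ->
  proj_V g VV X x = u.
Proof.
move=> vu ou.
have [vP oP] : VV x (proj_V g VV X x) /\ orth g VV x (X x - proj_V g VV X x).
  by apply: (@getPex _ [set u | VV x u /\ orth g VV x (X x - u)]); exists u.
apply/eqP; rewrite -subr_eq0; apply/eqP; apply: (@vertical_orth_eq0 x).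
  exact: verticalB.
have -> : proj_V g VV X x - u = (X x - u) - (X x - proj_V g VV X x).
  by rewrite opprB [RHS]addrC subrKA.
exact: orthB.
Qed.

End HorizontalLift.

(** * O'Neill's formula *)

Section ONeill.
Context {R : realType} {m p : nat} {M : manifold R m} {N : manifold R p}.
Variables (pi : M -> N) (gN : tensor2 N) (W : 'I_p -> field N).
Hypotheses (gNM : riem_metric gN) (sW : forall k, smooth_field (W k)).
Hypothesis oW : forall y i j, eval2 gN (W i) (W j) y = (i == j)%:R.
Variables (g : tensor2 M) (D : connection M) (H : 'I_p -> field M).
Hypotheses (gM : riem_metric g) (spi : smooth_map pi) (gD : levi_civita g D).
Hypothesis sH : forall k, smooth_field (H k).
Hypothesis rH : forall k, related pi (H k) (W k).
Hypothesis gH : forall k x u, tangent x u ->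
  g x (H k x) u = gN (pi x) (W k (pi x)) (push pi u).

Local Notation dot := (eval2 g).
Local Notation dotN := (eval2 gN).
Local Notation br := bracket.
Local Notation VV := (vertical pi).

Lemma LC_smooth X Y : smooth_field X -> smooth_field Y -> smooth_field (D X Y).
Proof. by case: gD => -[+ _ _] _ _; exact. Qed.

Lemma LC_torsion X Y x : smooth_field X -> smooth_field Y ->
  D Y X x = D X Y x - br X Y x.
Proof. by case: gD => _ T _ sX sY; rewrite -T // opprB addrCA subrr addr0. Qed.

Lemma LC_metric X Y Z x : smooth_field X -> smooth_field Y -> smooth_field Z ->
  act X (dot Y Z) x = dot (D X Y) Z x + dot Y (D X Z) x.
Proof. by move=> sX sY sZ; case: gD => _ _ mc; exact: mc. Qed.

Local Notation tg := smooth_field_tangent.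

Lemma dotC X Y x : smooth_field X -> smooth_field Y -> dot X Y x = dot Y X x.
Proof. by move=> sX sY; rewrite /eval2 (metricC gM) //; exact: tg. Qed.

Lemma act_cst X (f : M -> R) c x : smooth_field X -> f = (fun=> c) -> act X f x = 0.
Proof. by move=> sX ->; exact: tangent_cst (tg x sX). Qed.

(** The source of the base terms: inner products of a lift with projectable fields, brackets of
    lifts in particular, are functions on [N]. *)
Lemma dot_lift k X U x : smooth_field X -> related pi X U ->
  dot (H k) X x = dotN (W k) U (pi x).
Proof. by move=> sX rX; rewrite /eval2 gH ?rX //; exact: tg. Qed.

Lemma dot_lift_lift i j : dot (H i) (H j) = fun=> (i == j)%:R.
Proof. by apply/funext => x; rewrite (dot_lift _ _ (sH j) (rH j)) oW. Qed.

Lemma dot_lift_vertical k Z x : tangent_to VV Z -> dot (H k) Z x = 0.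
Proof.
move=> /tangent_to_vertical [sZ rZ]; rewrite (dot_lift _ _ sZ rZ).
rewrite /eval2 (metricC gNM) ?(metric0l gNM) //; try exact: tangent0;
  exact: smooth_field_tangent.
Qed.

Lemma lift_bracket_vertical k Z : tangent_to VV Z -> tangent_to VV (br (H k) Z).
Proof. by move=> vZ; apply: (vertical_bracketr vZ (sH k) (sW k) (rH k)). Qed.

(** Uses the orthonormal horizontal frame instead of [proj_V], whose pointwise choice does not
    exhibit smoothness. *)
Definition vertical_part (U : field M) : field M :=
  U + \sum_k (fun x => (- dot (H k) U x) *: H k x).

Lemma vertical_partE U x : vertical_part U x = U x - \sum_k dot (H k) U x *: H k x.
Proof.
rewrite /vertical_part -[(_ + _) x]/(U x + _); congr (_ + _).
by rewrite fct_sumE -sumrN; apply: eq_bigr => k _; rewrite scaleNr.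
Qed.

Lemma vertical_part_vertical U : smooth_field U -> tangent_to VV (vertical_part U).
Proof.
move=> sU; apply/tangent_to_vertical; split.
  apply: smooth_fieldD => //; apply: smooth_field_sum => k _.
  apply: smooth_fieldM => //.
  have -> : (fun x => - dot (H k) U x) = (fun x => (-1) * dot (H k) U x).
    by apply/funext => x; rewrite mulN1r.
  apply: smooth_fun_mul; [exact: smooth_fun_cst|exact: smooth_eval2].
move=> x; rewrite vertical_partE pushB.
have -> : push pi (\sum_k dot (H k) U x *: H k x) = \sum_k dot (H k) U x *: W k (pi x).
  apply: (big_ind2 (fun u w => push pi u = w)) => [|u u' s s' <- <-|k _].
  - exact: push0.
  - exact: pushD.
  - by rewrite pushZ rH.
have tU : tangent (pi x) (push pi (U x)) by apply: push_tangent => //; exact: tg.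
rewrite {1}(frame_expand gNM sW oW tU) -sumrB big1 // => k _.
rewrite [dot _ _ _]gH; last exact: tg.
by rewrite (metricC gNM tU (frame_tangent sW k _)) subrr.
Qed.

(** The vertical part of [U] is itself a smooth vertical field, so it may serve as test field and is
    then orthogonal to itself. *)
Lemma horizontal_expand U x : smooth_field U ->
  (forall Z, tangent_to VV Z -> dot U Z x = 0) ->
  U x = \sum_k dot (H k) U x *: H k x.
Proof.
move=> sU oU; have vZ := vertical_part_vertical sU.
have [sZ _] := vZ.
suff : vertical_part U x = 0 by rewrite vertical_partE => /eqP; rewrite subr_eq0 => /eqP.
apply: (metric_eq0 gM (tg x sZ)).
rewrite {1}vertical_partE (metricBl gM) ?[g x (U x) _]oU //; try exact: tg; last first.
  by apply: tangent_sum => k _; apply: tangentZ; exact: tg.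
rewrite sub0r (metric_suml gM) => [|k _|]; try exact: tg.
by rewrite big1 ?oppr0 // => k _; rewrite [g _ _ _]dot_lift_vertical // mulr0.
Qed.

Variables i j : 'I_p.
Hypothesis ij : i != j.
Let X := H i. Let Y := H j. Let Z := br X Y. Let Z' := br (W i) (W j).

Let sZ : smooth_field Z. Proof. exact: (smooth_bracket (sH i) (sH j)). Qed.
Let sZ' : smooth_field Z'. Proof. exact: smooth_bracket. Qed.
Let rZ : related pi Z Z'.
Proof. exact: (related_bracket (sW i) (sW j) (rH i) (rH j)). Qed.

Lemma LC_unit k l x : dot (H k) (D (H l) (H k)) x = 0.
Proof.
have := LC_metric x (sH l) (sH k) (sH k).
rewrite (act_cst _ (sH l) (dot_lift_lift k k)) (dotC x (LC_smooth (sH l) (sH k)) (sH k)) => E.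
by move: E; lra.
Qed.

Lemma LC_skew k l r x : dot (H k) (D (H l) (H r)) x = - dot (H r) (D (H l) (H k)) x.
Proof.
have := LC_metric x (sH l) (sH k) (sH r).
rewrite (act_cst _ (sH l) (dot_lift_lift k r)) (dotC x (LC_smooth (sH l) (sH k)) (sH r)) => E.
by move: E; lra.
Qed.

Lemma dotBr U A B x : smooth_field U -> smooth_field A -> smooth_field B ->
  g x (U x) (A x - B x) = dot U A x - dot U B x.
Proof. by move=> sU sA sB; rewrite (metricBr gM) //; exact: tg. Qed.

Lemma dot_LC_swap U k l x : smooth_field U ->
  dot U (D (H l) (H k)) x = dot U (D (H k) (H l)) x - dot U (br (H k) (H l)) x.
Proof.
move=> sU; rewrite {1}/eval2 (LC_torsion x (sH k) (sH l)) dotBr //; first exact: LC_smooth.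
exact: smooth_bracket.
Qed.

(** Koszul's formula for an orthonormal frame: the inner products are constant, so only the bracket
    term survives. *)
Lemma LC_diag k l x :
  dot (H k) (D (H l) (H l)) x = dotN (W l) (br (W k) (W l)) (pi x).
Proof.
rewrite LC_skew dot_LC_swap // LC_unit sub0r opprK.
by apply: dot_lift; [exact: smooth_bracket|exact: related_bracket].
Qed.

(** Against a vertical [V], metric compatibility moves the derivative to [D (H l) V], which may be
    replaced by [D V (H l)] as the bracket is vertical; the result is half the derivative along [V]
    of a constant square norm. *)
Lemma LC_diag_horizontal l x :
  D (H l) (H l) x = \sum_k dot (H k) (D (H l) (H l)) x *: H k x.
Proof.
apply: horizontal_expand => [|V vV]; first exact: LC_smooth.
have [sV _] := vV.
have := LC_metric x (sH l) (sH l) sV.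
rewrite (act_cst (c := 0) _ (sH l)); last first.
  by apply/funext => y; rewrite dot_lift_vertical.
rewrite {2}/eval2 (LC_torsion x sV (sH l)) (dotBr x (sH l) (LC_smooth sV (sH l))
  (smooth_bracket sV (sH l))).
have vVH : tangent_to VV (br V (H l)).
  exact: (vertical_bracketl vV (sH l) (sW l) (rH l)).
rewrite (dot_lift_vertical _ _ vVH).
have := LC_metric x sV (sH l) (sH l).
rewrite (act_cst _ sV (dot_lift_lift l l)) (dotC x (LC_smooth sV (sH l)) (sH l)).
lra.
Qed.

(** Koszul's formula for the part of [D X Y] symmetric in [X] and [Y], paired with [H k]: the term
    with the bracket of [X] and [Y] drops out by symmetry. *)
Definition LC_coef k (y : N) : R :=
  - (1 / 2) * (dotN (W j) (br (W i) (W k)) y + dotN (W i) (br (W j) (W k)) y).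

(* [Q] is horizontal: [D X Y = Q + Z / 2] and [D Y X = Q - Z / 2]. *)
Let Q : field M := fun x => (- (1 / 2)) *: Z x + D X Y x.

Let sQ : smooth_field Q.
Proof.
apply: smooth_field_lin => //; first exact: smooth_fun_cst.
exact: (LC_smooth (sH i) (sH j)).
Qed.

Lemma LC_coefE k x : dot (H k) Q x = LC_coef k (pi x).
Proof.
have tZ := tg x sZ; have tXY := tg x (LC_smooth (sH i) (sH j)); have tk := tg x (sH k).
rewrite /eval2 /Q (metricDr gM) ?(metricZr gM) //; last exact: tangentZ.
rewrite -[g x _ (Z x)]/(dot (H k) (br (H i) (H j)) x).
rewrite -[g x _ (D X Y x)]/(dot (H k) (D (H i) (H j)) x).
have E1 := dot_LC_swap i j x (sH k).
have E2 := dot_LC_swap i k x (sH j).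
have E3 := dot_LC_swap j k x (sH i).
have S1 := LC_skew k i j x.
have S2 := LC_skew k j i x.
have S3 := LC_skew i k j x.
have B1 : dot (H j) (br (H i) (H k)) x = dotN (W j) (br (W i) (W k)) (pi x).
  by apply: dot_lift; [exact: smooth_bracket|exact: related_bracket].
have B2 : dot (H i) (br (H j) (H k)) x = dotN (W i) (br (W j) (W k)) (pi x).
  by apply: dot_lift; [exact: smooth_bracket|exact: related_bracket].
rewrite /LC_coef -B1 -B2.
move: E1 E2 E3 S1 S2 S3.
move: (dot (H k) (D (H i) (H j)) x) (dot (H k) (D (H j) (H i)) x)
  (dot (H j) (D (H i) (H k)) x) (dot (H j) (D (H k) (H i)) x)
  (dot (H i) (D (H j) (H k)) x) (dot (H i) (D (H k) (H j)) x)
  (dot (H k) (br (H i) (H j)) x) (dot (H j) (br (H i) (H k)) x)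
  (dot (H i) (br (H j) (H k)) x) => a b c d e f u v w.
lra.
Qed.

Lemma LC_vertical k l V x : tangent_to VV V ->
  dot (H k) (D (H l) V) x = dot (H k) (D V (H l)) x.
Proof.
move=> vV; have [sV _] := vV.
rewrite {2}/eval2 (LC_torsion x (sH l) sV)
  (dotBr x (sH k) (LC_smooth (sH l) sV) (smooth_bracket (sH l) sV)).
by rewrite (dot_lift_vertical _ _ (lift_bracket_vertical l vV)) subr0.
Qed.

(** Against a vertical [V], the sum of [D X Y] and [D Y X] gives minus the derivative along [V] of
    the inner product of [X] and [Y], which is constant. *)
Lemma Q_horizontal x : Q x = \sum_k LC_coef k (pi x) *: H k x.
Proof.
rewrite (horizontal_expand (x := x) sQ).
  by apply: eq_bigr => k _; rewrite LC_coefE.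
move=> V vV; have [sV _] := vV.
rewrite {1}/eval2 /Q (metric_linl gM) //; try exact: tg;
  try exact: (tg x (LC_smooth (sH i) (sH j))).
rewrite -[g x (Z x) _]/(dot Z V x) -[g x (D X Y x) _]/(dot (D X Y) V x).
have E1 := LC_metric x (sH i) (sH j) sV.
rewrite (act_cst (c := 0) _ (sH i)) in E1; last first.
  by apply/funext => y; rewrite dot_lift_vertical.
have E2 := LC_metric x (sH j) (sH i) sV.
rewrite (act_cst (c := 0) _ (sH j)) in E2; last first.
  by apply/funext => y; rewrite dot_lift_vertical.
have E3 := LC_metric x sV (sH j) (sH i).
rewrite (act_cst _ sV (dot_lift_lift j i)) (dotC x (LC_smooth sV (sH j)) (sH i)) in E3.
have E4 := dot_LC_swap i j x sV.
rewrite (dotC x sV (LC_smooth (sH j) (sH i))) (dotC x sV (LC_smooth (sH i) (sH j))) in E4.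
rewrite (dotC x sV sZ) in E4.
rewrite !LC_vertical // in E1 E2.
rewrite -/X -/Y in E1 E2 E3 E4.
move: E1 E2 E3 E4.
move: (dot (D X Y) V x) (dot (D Y X) V x) (dot Y (D V X) x) (dot X (D V Y) x) (dot Z V x).
by move=> a b c d e; lra.
Qed.

Lemma dot_Q_Q x : dot Q Q x = \sum_k LC_coef k (pi x) ^+ 2.
Proof.
rewrite {1}/eval2 {1}Q_horizontal (metric_suml gM) => [|k _|]; try exact: tg.
by apply: eq_bigr => k _; rewrite [g _ _ _]LC_coefE.
Qed.

Lemma dot_Z_Q x : dot Z Q x = \sum_k dotN (W k) Z' (pi x) * LC_coef k (pi x).
Proof.
rewrite {1}/eval2 {1}Q_horizontal (metric_sumr gM) => [|k _|]; try exact: tg.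
apply: eq_bigr => k _; rewrite mulrC -[g x _ _]/(dot Z (H k) x) dotC //.
by rewrite (dot_lift _ _ sZ rZ).
Qed.

(** The vertical part of the bracket, twice O'Neill's A-tensor on [X], [Y]. Its coefficients are
    read on the base, so they do not move when the metric on [M] does. *)
Definition ONeill_tensor : field M :=
  fun x => Z x - \sum_k dotN Z' (W k) (pi x) *: H k x.

Lemma ONeill_tensorE : ONeill_tensor = vertical_part Z.
Proof.
apply/funext => x; rewrite vertical_partE; congr (_ - _); apply: eq_bigr => k _.
rewrite (dot_lift _ _ sZ rZ) /eval2 (metricC gNM) //; exact: smooth_field_tangent.
Qed.

Lemma ONeill_tensor_vertical : tangent_to VV ONeill_tensor.
Proof. by rewrite ONeill_tensorE; exact: vertical_part_vertical. Qed.

Lemma dot_Z_Z x : dot Z Z x =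
  dot ONeill_tensor ONeill_tensor x + \sum_k dotN (W k) Z' (pi x) ^+ 2.
Proof.
have vA := ONeill_tensor_vertical; have [sA _] := vA.
pose h := \sum_k dotN (W k) Z' (pi x) *: H k x.
have th : tangent x h by apply: tangent_sum => k _; apply: tangentZ; exact: tg.
have ZE : Z x = ONeill_tensor x + h.
  rewrite ONeill_tensorE vertical_partE; have -> : \sum_k dot (H k) Z x *: H k x = h.
    by apply: eq_bigr => k _; rewrite (dot_lift _ _ sZ rZ).
  by rewrite subrK.
have hA : g x h (ONeill_tensor x) = 0.
  rewrite (metric_suml gM) => [|k _|]; try exact: tg.
  by rewrite big1 // => k _; rewrite [g _ _ _]dot_lift_vertical // mulr0.
have hh : g x h h = \sum_k dotN (W k) Z' (pi x) ^+ 2.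
  rewrite {1}/h (metric_suml gM) => [|k _|//]; last exact: tg.
  apply: eq_bigr => k _; have <- : ONeill_tensor x + h - ONeill_tensor x = h.
    by rewrite addrAC subrr add0r.
  rewrite -ZE (metricBr gM) ?[g x (H k x) (ONeill_tensor x)]dot_lift_vertical //; try exact: tg.
  by rewrite subr0 [g _ _ _](dot_lift k x sZ rZ).
have tA := tg x sA; rewrite /eval2; move: tA ZE hA.
move: (ONeill_tensor x) => A tA -> hA.
have tAh : tangent x (A + h) by exact: tangentD.
rewrite (metricDl gM tA th tAh) (metricDr gM tA th tA) (metricDr gM tA th th) hA hh.
by rewrite (metricC gM tA th) hA addr0 add0r.
Qed.

(** The terms of the curvature that descend to [N]. The sum with factor 3/4 is the horizontal share
    of the square norm of the bracket; the last line comes from the derivative along the bracket. *)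
Definition base_curvature (y : N) : R :=
  act (W i) (dotN (W j) Z') y - act (W j) (dotN (W i) Z') y
  - \sum_k dotN (W j) (br (W k) (W j)) y * dotN (W i) (br (W k) (W i)) y
  + \sum_k LC_coef k y ^+ 2 + \sum_k dotN (W k) Z' y * LC_coef k y
  - 3 / 4 * \sum_k dotN (W k) Z' y ^+ 2
  - (act (W j) (dotN (W i) Z') y + dotN (W i) (br Z' (W j)) y).

Lemma sec_lift x : sec g D X Y x =
  base_curvature (pi x) - 3 / 4 * dot ONeill_tensor ONeill_tensor x.
Proof.
have sXY := LC_smooth (sH i) (sH j); have sYX := LC_smooth (sH j) (sH i).
have sYY := LC_smooth (sH j) (sH j); have sXX := LC_smooth (sH i) (sH i).
have den : dot X X x * dot Y Y x - dot X Y x ^+ 2 = 1.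
  by rewrite !dot_lift_lift !eqxx (negbTE ij) mulr1 expr0n subr0.
rewrite /sec den divr1.
have -> : eval2 g (curvature D X Y Y) X x =
    dot (D X (D Y Y)) X x - dot (D Y (D X Y)) X x - dot (D Z Y) X x.
  have t1 := tg x (LC_smooth (sH i) sYY); have t2 := tg x (LC_smooth (sH j) sXY).
  have t3 := tg x (LC_smooth sZ (sH j)); have tX := tg x (sH i).
  by rewrite /eval2 /curvature (metricBl gM (tangentB t1 t2) t3 tX) (metricBl gM t1 t2 tX).
(* Metric compatibility trades second covariant derivatives for products of first ones and the
   derivative of an inner product; as that inner product descends to [N], so does its derivative
   along a lift. *)
have F1 : dot (D Y Y) X = (dotN (W j) Z') \o pi.
  apply/funext => y; rewrite (dotC y sYY (sH i)) (LC_diag i j).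
  by [].
have F2 : dot (D X Y) X = (dotN (W i) Z') \o pi.
  apply/funext => y; rewrite (dotC y sXY (sH i)).
  have := dot_LC_swap i j y (sH i); rewrite LC_unit => /esym/eqP.
  by rewrite subr_eq0 => /eqP ->; exact: dot_lift.
have sN1 : smooth_fun (dotN (W j) Z') by exact: smooth_eval2.
have sN2 : smooth_fun (dotN (W i) Z') by exact: smooth_eval2.
have E1 := LC_metric x (sH i) sYY (sH i).
rewrite F1 (related_act x (rH i) sN1) in E1.
have E2 := LC_metric x (sH j) sXY (sH i).
rewrite F2 (related_act x (rH j) sN2) in E2.
have E3 : dot (D Y Y) (D X X) x =
    \sum_k dotN (W j) (br (W k) (W j)) (pi x) * dotN (W i) (br (W k) (W i)) (pi x).
  rewrite {1}/eval2 [D Y Y x]LC_diag_horizontal (metric_suml gM) => [|k _|]; try exact: tg.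
  by apply: eq_bigr => k _; rewrite LC_diag [g _ _ _]LC_diag.
have DXY : D X Y x = Q x + (1 / 2) *: Z x.
  by rewrite /Q scaleNr addrAC addNr add0r.
have DYX : D Y X x = Q x - (1 / 2) *: Z x.
  rewrite (LC_torsion x (sH i) (sH j)) -/X -/Y DXY -addrA; congr (_ + _).
  rewrite -[X in _ - X]scale1r -scalerBl -scaleNr; congr (_ *: _).
  lra.
have tZ := tg x sZ; have tQ := tg x sQ; have tX := tg x (sH i).
have tZ2 : tangent x ((1 / 2) *: Z x) by exact: tangentZ.
have E4 : dot (D X Y) (D Y X) x = dot Q Q x - 1 / 4 * dot Z Z x.
  rewrite {1}/eval2 DXY DYX (metricDl gM) ?(metricBr gM) ?(metricZl gM) ?(metricZr gM) //;
    try exact: tangentB.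
  rewrite (metricC gM tQ tZ) /eval2; lra.
have E5 := LC_metric x (sH j) sZ (sH i).
have F3 : dot Z X = (dotN (W i) Z') \o pi.
  by apply/funext => y; rewrite (dotC y sZ (sH i)); exact: (dot_lift i y sZ rZ).
rewrite F3 (related_act x (rH j) sN2) in E5.
have E6 : dot (D Z Y) X x = dot (D Y Z) X x + dotN (W i) (br Z' (W j)) (pi x).
  rewrite -(dot_lift i x (smooth_bracket sZ (sH j)) (related_bracket sZ' (sW j) rZ (rH j))).
  rewrite (dotC x (sH i)); last exact: smooth_bracket.
  rewrite /eval2 -(metricDl gM (tg x (LC_smooth (sH j) sZ))
    (tg x (smooth_bracket sZ (sH j))) tX).
  by rewrite (LC_torsion x sZ (sH j)) subrK.
have E7 : dot Z (D Y X) x = dot Z Q x - 1 / 2 * dot Z Z x.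
  by rewrite {1}/eval2 DYX (metricBr gM) ?(metricZr gM).
rewrite dot_Q_Q in E4; rewrite dot_Z_Q in E7; rewrite dot_Z_Z in E4 E7.
rewrite /base_curvature -E3.
move: E1 E2 E4 E5 E6 E7; rewrite -/X -/Y.
move: (act (W i) _ _) (act (W j) _ _) (dot (D X (D Y Y)) X x) (dot (D Y (D X Y)) X x)
  (dot (D Z Y) X x) (dot (D Y Z) X x) (dot (D Y Y) (D X X) x) (dot (D X Y) (D Y X) x)
  (dot Z (D Y X) x) (dot ONeill_tensor ONeill_tensor x) (dotN (W i) (br Z' (W j)) (pi x))
  (\sum_k LC_coef k (pi x) ^+ 2) (\sum_k dotN (W k) Z' (pi x) ^+ 2)
  (\sum_k dotN (W k) Z' (pi x) * LC_coef k (pi x)) => a b c d e f h o q r s t u v.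
lra.
Qed.

End ONeill.

(** * Variations of the metric *)

Section TangentCurve.
Context {R : realType} {m : nat} {M : manifold R m}.
Variables (x : M) (t : R).

(** The metric is fixed and only the vectors move; cut-off coordinates turn derivatives tested on
    functions into derivatives of coefficients. *)
Lemma metric_is_derive (h : tensor2 M) (u v : R -> (M -> R) -> R) u' v' : riem_metric h ->
  (\forall s \near t, tangent x (u s)) -> (\forall s \near t, tangent x (v s)) ->
  tangent x u' -> tangent x v' ->
  (forall f, is_derive t 1 (fun s => u s f) (u' f)) ->
  (forall f, is_derive t 1 (fun s => v s f) (v' f)) ->
  is_derive t 1 (fun s => h x (u s) (v s)) (h x u' (v t) + h x (u t) v').
Proof.
move=> hM tu tv tu' tv' du dv.
have [a aa ax] := atlas_cover x; have [F [_ dF]] := coord_vec_dual aa ax.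
have E w w' : tangent x w -> tangent x w' ->
    h x w w' = \sum_i \sum_j w (F i) * w' (F j) * component h a i j x.
  move=> tw tw'.
  rewrite {1}(tangent_dual aa ax dF tw) {1}(tangent_dual aa ax dF tw').
  by rewrite (metric_coord hM) //; apply: eq_bigr => i _; rewrite -(tangent_dual aa ax dF tw').
apply: (near_eq_is_derive (f := \sum_i \sum_j (fun s : R =>
    u s (F i) * (v s (F j) * component h a i j x)))).
  apply: filterS2 tu tv => s tus tvs.
  rewrite E // fct_sumE; apply: eq_bigr => i _.
  by rewrite fct_sumE; apply: eq_bigr => j _; rewrite mulrA.
have -> : h x u' (v t) + h x (u t) v' =
    \sum_i \sum_j (u' (F i) * (v t (F j) * component h a i j x)
               + u t (F i) * (v' (F j) * component h a i j x)).
  have tut : tangent x (u t) by exact: nbhs_singleton tu.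
  have tvt : tangent x (v t) by exact: nbhs_singleton tv.
  rewrite !E //.
  rewrite -big_split; apply: eq_bigr => i _; rewrite -big_split; apply: eq_bigr => j _ /=.
  by rewrite !mulrA.
apply: is_derive_sum => i; apply: is_derive_sum => j.
exact: (is_derive_mul_cst (component h a i j x) (du (F i)) (dv (F j))).
Qed.

End TangentCurve.

Section BracketOpp.
Context {R : realType} {m : nat} {M : manifold R m}.
Implicit Types (X Y : field M).

(** Linearity in the function is not part of the type of [v]; it comes from the coordinate form, and
    from [- f] failing to be smooth together with [f]. *)
Lemma tangentN (x : M) v (f : M -> R) : tangent x v -> v (- f) = - v f.
Proof.
move=> tv; have [sf|sf] := pselect (smooth_fun f); last first.
  rewrite !(tangent_vanish tv) ?oppr0 // => sf'; apply: sf => a aa.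
  apply: (eq_Cinf (f := fun u => -1 * ((- f) \o from a) u)).
  - exact: cod_open.
  - by move=> u _ /=; rewrite mulN1r opprK.
  - by apply: Cinf_mul; [exact: cod_open|apply: Cinf_cst; exact: cod_open|exact: sf'].
have [a [c [aa ax ->]]] := tv.
have sf' : smooth_fun (- f).
  move=> b ab; apply: (eq_Cinf (f := fun u => -1 * (f \o from b) u)).
  - exact: cod_open.
  - by move=> u _ /=; rewrite mulN1r.
  - by apply: Cinf_mul; [exact: cod_open|apply: Cinf_cst; exact: cod_open|exact: sf].
rewrite !fct_lincombE -sumrN; apply: eq_bigr => i _.
rewrite !coord_vecE // -mulrN; congr (_ * _).
have [df _] := Cinf_is_derive i (sf a aa) (to_cod ax).
exact: deriveN df.
Qed.

Lemma bracketNl X Y : smooth_field X -> smooth_field Y -> bracket (- X) Y = - bracket X Y.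
Proof.
move=> sX sY; apply/funext => x; apply/funext => f.
rewrite -[RHS]/(- (X x (act Y f) - Y x (act X f))).
rewrite -[LHS]/(- X x (act Y f) - Y x (- act X f)).
by rewrite (tangentN _ (smooth_field_tangent x sY)) opprB opprK addrC.
Qed.

Lemma bracketNr X Y : smooth_field X -> smooth_field Y -> bracket X (- Y) = - bracket X Y.
Proof.
move=> sX sY; apply/funext => x; apply/funext => f.
rewrite -[RHS]/(- (X x (act Y f) - Y x (act X f))).
rewrite -[LHS]/(X x (- act Y f) - - Y x (act X f)).
by rewrite (tangentN _ (smooth_field_tangent x sX)) opprB opprK addrC.
Qed.

End BracketOpp.

(** * Time derivatives of the lifts, of the O'Neill tensor and of the curvature *)

Section Variation.
Context {R : realType} {m p : nat} {M : manifold R m} {N : manifold R p}.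
Variables (pi : M -> N) (gN : tensor2 N) (eps : R) (g : R -> tensor2 M).
Variables (W : 'I_p -> field N).
Local Notation VV := (vertical pi).
Hypotheses (gNM : riem_metric gN) (vg : variation VV eps g).
Hypothesis sub : forall t, `|t| < eps -> riem_submersion pi (g t) gN.
Hypothesis sW : forall i, smooth_field (W i).
Hypothesis oW : forall y i j, eval2 gN (W i) (W j) y = (i == j)%:R.

Definition lift (t : R) (i : 'I_p) : field M := proj_H (g t) VV (hlift pi (g 0) (W i)).

Let time0 : `|0 : R| < eps.
Proof. by case: vg => e0 _ _; rewrite normr0. Qed.

Let spi : smooth_map pi. Proof. by case: (sub time0). Qed.

Lemma variation_metric t : `|t| < eps -> riem_metric (g t).
Proof. by case: vg => _ + _ te => /(_ t te)[]. Qed.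

Lemma variation_vertical t X Y x : `|t| < eps -> tangent_to VV X -> tangent_to VV Y ->
  g t x (X x) (Y x) = g 0 x (X x) (Y x).
Proof.
by case: vg => _ + _ te vX vY => /(_ t te)[_ /(_ X Y vX vY x)].
Qed.

Lemma lift_spec t k x : `|t| < eps ->
  [/\ orth (g t) VV x (lift t k x), push pi (lift t k x) = W k (pi x) &
   forall u, tangent x u -> g t x (lift t k x) u = gN (pi x) (W k (pi x)) (push pi u)].
Proof.
move=> te.
have [[t0 _] p0] := hlift_spec gNM sW oW (variation_metric time0) (sub time0) x k.
exact: (proj_H_spec gNM sW oW (variation_metric te) (sub te)).
Qed.

Lemma lift_riesz t k x u : `|t| < eps -> tangent x u ->
  g t x (lift t k x) u = gN (pi x) (W k (pi x)) (push pi u).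
Proof. by move=> te; have [_ _] := lift_spec k x te; exact. Qed.

Lemma lift_related t k : `|t| < eps -> related pi (lift t k) (W k).
Proof. by move=> te x; have [] := lift_spec k x te. Qed.

Lemma lift_coord a t k x : atlas a -> `|t| < eps -> dom a x ->
  lift t k x = \sum_i riesz_coord (g t) a x
    (fun j => gN (pi x) (W k (pi x)) (push pi (coord_vec a j x))) i *: coord_vec a i x.
Proof.
move=> aa te ax; have gM := variation_metric te.
have tc i : tangent x (coord_vec a i x) by exact: coord_vec_tangent.
have [[tl _] _ lr] := lift_spec k x te.
apply: (metric_inj gM tl); first exact: lincomb_tangent.
move=> w /(tangent_coord aa ax)[c ->].
rewrite !(metric_sumr gM) //; last exact: lincomb_tangent.
by apply: eq_bigr => i _; rewrite lr // (riesz_coordE gM).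
Qed.

(** In the Riesz formula the covector is independent of time and smooth, and the inverse Gram matrix
    is jointly smooth. *)
Lemma lift_time_smooth k : time_smooth_field eps (fun t => lift t k).
Proof.
move=> a aa; exists (fun i t x => riesz_coord (g t) a x
    (fun j => gN (pi x) (W k (pi x)) (push pi (coord_vec a j x))) i); last first.
  by move=> t x te ax; exact: lift_coord.
move=> i; have oT := @time_dom_open R m M eps a.
rewrite /time_smooth -/(time_dom eps a) /riesz_coord.
apply: Cinf_sum => // j _; apply: Cinf_mul => //.
  apply: (@Cinf_comp _ _ _ (time_dom eps a) (cod a)
    (fun v : 'rV[R]_(1 + m) => rsubmx v : 'rV[R]_m)
    (fun u => gN (pi (from a u)) (W k (pi (from a u))) (push pi (coord_vec a j (from a u))))) => //.
  - exact: cod_open.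
  - by move=> v [].
  - move=> l; apply: (eq_Cinf (f := fun v : 'rV[R]_(1 + m) => v 0 (rshift 1 l))) => //.
      by move=> v _; rewrite mxE.
    exact: Cinf_coord.
  - exact: (Cinf_pullback_form spi gNM (sW k) j aa).
apply: (Cinf_invmx j i (A := fun v : 'rV[R]_(1 + m) =>
   gram (g (lsubmx v 0 0)) a (from a (rsubmx v)))) => //.
- move=> v [te av]; apply: (gram_unit (variation_metric te)) => //; exact: from_dom.
- move=> r l; case: vg => _ _ /(_ a r l aa).
  move=> sc; apply: (eq_Cinf oT _ sc) => v _.
  by rewrite [RHS]mxE.
Qed.

Lemma lift_smooth t k : `|t| < eps -> smooth_field (lift t k).
Proof. exact: time_smooth_field_at (lift_time_smooth k). Qed.

Lemma lift_orthonormal t i j x : `|t| < eps -> g t x (lift t i x) (lift t j x) = (i == j)%:R.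
Proof.
move=> te; rewrite lift_riesz // ?lift_related //; first exact: oW.
exact: smooth_field_tangent (lift_smooth j te).
Qed.

Lemma component_is_derive a j k (t : R) x : atlas a -> `|t| < eps -> dom a x ->
  is_derive t 1 (fun s => component (g s) a j k x) (dt (fun s => component (g s) a j k) t x).
Proof.
by move=> aa te ax; case: vg => _ _ /(_ a j k aa) sc; exact: time_smooth_is_derive_dt sc te ax.
Qed.

Lemma metric_coord_is_derive a (q : 'I_m -> R -> R) q' c (t : R) x :
  atlas a -> `|t| < eps -> dom a x -> (forall j, is_derive t 1 (q j) (q' j)) ->
  is_derive t 1
    (fun s => g s x (\sum_j q j s *: coord_vec a j x) (\sum_k c k *: coord_vec a k x))
    (\sum_j \sum_k (q' j * (component (g t) a j k x * c k) +
       q j t * (dt (fun s => component (g s) a j k) t x * c k))).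
Proof.
move=> aa te ax dq.
apply: (near_eq_is_derive (f := \sum_j \sum_k (fun s : R =>
    q j s * (component (g s) a j k x * c k)))).
  have := near_time te; apply: filterS => s se.
  rewrite (metric_coord (variation_metric se)) // fct_sumE; apply: eq_bigr => j _.
  rewrite fct_sumE; apply: eq_bigr => k _.
  by rewrite mulrA mulrAC.
apply: is_derive_sum => j; apply: is_derive_sum => k.
exact: (is_derive_mul_cst (c k) (dq j) (component_is_derive j k aa te ax)).
Qed.

Lemma metric_time_is_derive (u : R -> (M -> R) -> R) u' w (t : R) x : `|t| < eps ->
  (\forall s \near t, tangent x (u s)) -> tangent x u' -> tangent x w ->
  (forall f, is_derive t 1 (fun s => u s f) (u' f)) ->
  is_derive t 1 (fun s => g s x (u s) w) (g t x u' w + dt_tensor g t x (u t) w).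
Proof.
move=> te tu tu' tw du.
have [a aa ax] := atlas_cover x; have [F [_ dF]] := coord_vec_dual aa ax.
have gM := variation_metric te.
have [c cE] := tangent_coord aa ax tw.
have D0 (e : 'I_m -> R) := metric_coord_is_derive c aa te ax (fun j => is_derive_cst (e j) t 1).
have D := metric_coord_is_derive c aa te ax (fun j => du (F j)).
have -> : g t x u' w + dt_tensor g t x (u t) w =
   \sum_j \sum_k (u' (F j) * (component (g t) a j k x * c k) +
       u t (F j) * (dt (fun s => component (g s) a j k) t x * c k)).
  rewrite [in g t x u' w](tangent_dual aa ax dF tu') cE (metric_coord gM) //.
  rewrite /dt_tensor derive1E {1}(tangent_dual aa ax dF (nbhs_singleton tu)).
  have [_ ->] := D0 (fun j => u t (F j)).
  rewrite -big_split; apply: eq_bigr => j _; rewrite -big_split; apply: eq_bigr => k _ /=.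
  by rewrite mul0r add0r; congr (_ + _); rewrite mulrAC mulrA.
apply: near_eq_is_derive D; apply: filterS tu => s tus.
by rewrite -(tangent_dual aa ax dF tus) -cE.
Qed.

Lemma dt_tensorC t x u w : `|t| < eps -> tangent x u -> tangent x w ->
  dt_tensor g t x u w = dt_tensor g t x w u.
Proof.
move=> te tu tw; rewrite /dt_tensor !derive1E; apply: near_eq_derive.
have := near_time te; apply: filterS => s se.
exact: (metricC (variation_metric se)).
Qed.

(** [dt_tensor] is a bare [derive1], total by convention; here it is shown to be a genuine
    derivative, from which its linearity follows. *)
Lemma dt_tensor_is_derive (t : R) x u w : `|t| < eps -> tangent x u -> tangent x w ->
  is_derive t 1 (fun s => g s x u w) (dt_tensor g t x u w).
Proof.
move=> te tu tw; have gM := variation_metric te.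
have tuN : \forall s \near t, tangent x ((fun _ : R => u) s) by exact: filterE.
have := @metric_time_is_derive (fun=> u) 0 w t x te tuN (tangent0 x) tw.
rewrite (metric0l gM tw) add0r; apply => // f; exact: is_derive_cst.
Qed.

Lemma dt_tensor_linr t x (k : R) u v w : `|t| < eps ->
  tangent x u -> tangent x v -> tangent x w ->
  dt_tensor g t x w (k *: u + v) = k * dt_tensor g t x w u + dt_tensor g t x w v.
Proof.
move=> te tu tv tw.
have D := is_deriveD (is_deriveZ k (dt_tensor_is_derive te tw tu)) (dt_tensor_is_derive te tw tv).
rewrite {1}/dt_tensor derive1E; have [_ <-] := D; apply: near_eq_derive.
have := near_time te; apply: filterS => s se; have gM := variation_metric se.
by rewrite (metricDr gM) ?(metricZr gM) //; exact: tangentZ.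
Qed.

Lemma sharp_spec t x u : `|t| < eps -> tangent x u ->
  forall v, tangent x v ->
  g t x (sharp (g t) (dt_tensor g t) x u) v = dt_tensor g t x u v.
Proof.
move=> te tu; have [h th hE] := @riesz _ _ _ _ (variation_metric te) x
  (dt_tensor g t x u) (fun k v w tv tw => dt_tensor_linr k te tv tw tu).
by have [_ +] := @getPex _ [set w | tangent x w /\ forall v, tangent x v ->
  g t x w v = dt_tensor g t x u v] (ex_intro _ h (conj th hE)).
Qed.

Variable V : 'I_p -> R -> field M.
Hypothesis sV : forall i, time_smooth_field eps (V i).
Hypothesis vV : forall i t, `|t| < eps -> tangent_to VV (V i t).
Hypothesis shV : forall t, `|t| < eps -> forall X, tangent_to VV X -> forall x,
  sharp (g t) (dt_tensor g t) x (X x) =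
  \sum_i eval2 (g 0) (V i t) X x *: lift t i x.

(** The push-forward is constant in time, so its derivative is 0. Used with [U] a frame field for
    the lifts, and with [U] zero for the [V k]. *)
Lemma dt_field_vertical (X : R -> field M) (U : field N) t : `|t| < eps ->
  time_smooth_field eps X -> (forall s, `|s| < eps -> related pi (X s) U) ->
  tangent_to VV (dt_field X t).
Proof.
move=> te sX rX; apply/tangent_to_vertical.
split; first exact: time_smooth_field_at (time_smooth_dt_field sX) te.
move=> x; apply/funext => f.
have [sf|sf] := pselect (smooth_fun f); last by rewrite push_nonsmooth.
rewrite pushE // /dt_field derive1E -[RHS]/(0 : R) -(derive_cst (U (pi x) f) t 1).
apply: near_eq_derive; have := near_time te; apply: filterS => s se.
by rewrite -(rX s se x) pushE.
Qed.

(** The test field is [D + V k t]. Pairing its image under [sharp] with the lift leaves the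
    coefficient with [V k], taken for [g 0]; verticality turns this into a [g t] product, and
    [D + V k t] has length zero. *)
Lemma dt_lift t k : `|t| < eps -> dt_field (fun s => lift s k) t = - V k t.
Proof.
move=> te; set D := dt_field _ _; have gM := variation_metric te.
have vD : tangent_to VV D.
  by apply: dt_field_vertical (lift_time_smooth k) _ => // s; exact: lift_related.
have vk := vV k te; have vZ := tangent_to_verticalD vD vk.
have [sD _] := vD; have [sk _] := vk; have [sZ _] := vZ.
apply/funext => x; apply/eqP; rewrite -subr_eq0; apply/eqP.
rewrite -[(- V k t) x]/(- V k t x) opprK -[LHS]/((D + V k t) x).
have tD := smooth_field_tangent x sD; have tk := smooth_field_tangent x sk.
have tZ := smooth_field_tangent x sZ; have tl i := smooth_field_tangent x (lift_smooth i te).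
apply: (metric_eq0 gM tZ); rewrite -{1}[(D + V k t) x]/(D x + V k t x) (metricDl gM) //.
have : is_derive t 1 (fun s => g s x (lift s k x) ((D + V k t) x)) 0.
  apply: (near_eq_is_derive (f := cst 0)).
  have := near_time te; apply: filterS => s se.
  have [[_ ol] _ _] := lift_spec k x se; rewrite ol //.
  by case: vZ.
have du f := time_smooth_field_is_derive x f (lift_time_smooth k) te.
have tls : \forall s \near t, tangent x (lift s k x).
  have := near_time te; apply: filterS => s se.
  exact: smooth_field_tangent (lift_smooth k se).
have [_ DE] := metric_time_is_derive te tls tD tZ du.
move=> [_]; rewrite DE => E0.
have := sharp_spec te tZ (tl k); rewrite shV // (metric_suml gM) // (bigD1 k) //=.
rewrite lift_orthonormal // eqxx mulr1 big1 ?addr0; last first.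
  by move=> l lk; rewrite lift_orthonormal // (negbTE lk) mulr0.
rewrite dt_tensorC // -[eval2 _ _ _ _]/(g 0 x (V k t x) ((D + V k t) x)) -(variation_vertical x te vk vZ).
by move=> ->.
Qed.


Variables i j : 'I_p.
Let c (k : 'I_p) : N -> R := eval2 gN (bracket (W i) (W j)) (W k).
Let L (k : 'I_p) : R -> field M := fun s => lift s k.
Let A (t : R) : field M := ONeill_tensor pi gN W (lift t) i j.
Let C (t : R) : field M := bracket (V i t) (L j t) + bracket (L i t) (V j t).
Let dV (k : 'I_p) (t : R) : field M := dt_field (V k) t.
Let C' (t : R) : field M := bracket (dV i t) (L j t) + bracket (L i t) (dV j t).

(** With [U] the lifts this is the horizontal part of their bracket; the coefficients are constant
    in time, so differentiation acts on [U] only. *)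
Let coefsum (U : 'I_p -> field M) : field M := \sum_k (fun x => c k (pi x) *: U k x).

Let dA (t : R) : field M := coefsum (fun k => V k t) - C t.
(** Both lifts in [C] have velocity minus [V], so each bracket of [C] contributes minus the bracket
    of [V i] and [V j]; as [C] enters [dA] with a minus sign, that bracket appears twice with a
    plus. *)
Let ddA (t : R) : field M :=
  coefsum (fun k => dV k t) - C' t + (bracket (V i t) (V j t) + bracket (V i t) (V j t)).

Lemma coefsumE U x : coefsum U x = \sum_k c k (pi x) *: U k x.
Proof. by rewrite /coefsum fct_sumE. Qed.

Lemma coefsumfE U x f : coefsum U x f = \sum_k c k (pi x) * U k x f.
Proof. by rewrite coefsumE fct_lincombE. Qed.

Lemma coefsum_vertical U : (forall k, tangent_to VV (U k)) -> tangent_to VV (coefsum U).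
Proof.
move=> vU; apply: tangent_to_vertical_sum => k _.
apply: tangent_to_verticalM => //; apply: smooth_comp => //.
by apply: smooth_eval2 => //; exact: smooth_bracket.
Qed.

Lemma tangent_to_verticalN X : tangent_to VV X -> tangent_to VV (- X).
Proof.
move=> vX; have -> : - X = (fun x => (-1 : R) *: X x).
  by apply/funext => x; rewrite scaleN1r.
by apply: tangent_to_verticalM => //; exact: smooth_fun_cst.
Qed.

Lemma dV_vertical k t : `|t| < eps -> tangent_to VV (dV k t).
Proof.
move=> te; apply: (dt_field_vertical (U := 0) te (sV k)) => s se.
by have /tangent_to_vertical [] := vV k se.
Qed.

Lemma bracket_lift_vertical U1 U2 t : `|t| < eps -> tangent_to VV U1 -> tangent_to VV U2 ->
  tangent_to VV (bracket U1 (L j t) + bracket (L i t) U2).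
Proof.
move=> te v1 v2; apply: tangent_to_verticalD.
  exact: (vertical_bracketl v1 (lift_smooth j te) (sW j) (lift_related j te)).
exact: (vertical_bracketr v2 (lift_smooth i te) (sW i) (lift_related i te)).
Qed.

Lemma C_vertical t : `|t| < eps -> tangent_to VV (C t).
Proof. by move=> te; apply: bracket_lift_vertical => //; exact: vV. Qed.

Lemma A_vertical t : `|t| < eps -> tangent_to VV (A t).
Proof.
move=> te; apply: (ONeill_tensor_vertical gNM sW oW (variation_metric te) spi) => //.
- by move=> k; exact: lift_smooth.
- by move=> k; exact: lift_related.
- by move=> k x u; exact: lift_riesz.
Qed.

Lemma dA_vertical t : `|t| < eps -> tangent_to VV (dA t).
Proof.
move=> te; apply: tangent_to_verticalD.
  by apply: coefsum_vertical => k; exact: vV.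
by apply: tangent_to_verticalN; exact: C_vertical.
Qed.

Lemma VV_bracket_vertical t : `|t| < eps -> tangent_to VV (bracket (V i t) (V j t)).
Proof.
move=> te; have /tangent_to_vertical [sj rj] := vV j te.
exact: (vertical_bracketl (vV i te) sj (@smooth_field0 _ _ N) rj).
Qed.

Lemma ddA_vertical t : `|t| < eps -> tangent_to VV (ddA t).
Proof.
move=> te; have vb := VV_bracket_vertical te.
apply: tangent_to_verticalD; last exact: tangent_to_verticalD.
apply: tangent_to_verticalD.
  by apply: coefsum_vertical => k; exact: dV_vertical.
by apply: tangent_to_verticalN; apply: bracket_lift_vertical => //; exact: dV_vertical.
Qed.

Lemma coefsum_is_derive (U : 'I_p -> R -> field M) (t : R) x f : `|t| < eps ->
  (forall k, time_smooth_field eps (U k)) ->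
  is_derive t 1 (fun s => coefsum (fun k => U k s) x f)
    (coefsum (fun k => dt_field (U k) t) x f).
Proof.
move=> te sU; rewrite coefsumfE.
have -> : (fun s => coefsum (fun k => U k s) x f) =
    \sum_k (fun s : R => c k (pi x) *: U k s x f).
  by apply/funext => s; rewrite coefsumfE fct_sumE.
apply: is_derive_sum => k; apply: is_deriveZ.
exact: time_smooth_field_is_derive.
Qed.

Lemma A_fE t x f : A t x f =
  bracket (L i t) (L j t) x f - coefsum (fun k => L k t) x f.
Proof. by rewrite coefsumE. Qed.

Lemma dt_L k t : `|t| < eps -> dt_field (L k) t = - V k t.
Proof. exact: dt_lift. Qed.

Lemma A_is_derive (t : R) x f : `|t| < eps ->
  is_derive t 1 (fun s => A s x f) (dA t x f).
Proof.
move=> te.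
have sL k : time_smooth_field eps (L k) by exact: lift_time_smooth.
have D := is_deriveB (bracket_is_derive x f (sL i) (sL j) te) (coefsum_is_derive x f te sL).
have -> : (fun s => A s x f) =
    (fun s => bracket (L i s) (L j s) x f) - (fun s => coefsum (fun k => L k s) x f).
  by apply/funext => s; rewrite A_fE.
apply: is_derive_eq D _.
have sVt k := time_smooth_field_at (sV k) te; have sLt k := lift_smooth k te.
rewrite !dt_L // (bracketNl (sVt i) (sLt j)) (bracketNr (sLt i) (sVt j)) -opprD -/(C t).
rewrite -[(- C t) x f]/(- C t x f) -[dA t x f]/(coefsum (fun k => V k t) x f - C t x f).
rewrite addrC; congr (_ - _).
rewrite !coefsumfE -sumrN; apply: eq_bigr => k _.
by rewrite dt_L // -[(- V k t) x f]/(- V k t x f) mulrN opprK.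
Qed.

Lemma C_is_derive (t : R) x f : `|t| < eps ->
  is_derive t 1 (fun s => C s x f)
    ((C' t - (bracket (V i t) (V j t) + bracket (V i t) (V j t))) x f).
Proof.
move=> te.
have sL k : time_smooth_field eps (L k) by exact: lift_time_smooth.
have D := is_deriveD (bracket_is_derive x f (sV i) (sL j) te)
  (bracket_is_derive x f (sL i) (sV j) te).
have -> : (fun s => C s x f) =
    (fun s => bracket (V i s) (L j s) x f) + (fun s => bracket (L i s) (V j s) x f).
  by [].
apply: is_derive_eq D _.
have sVt k := time_smooth_field_at (sV k) te; have sLt k := lift_smooth k te.
rewrite !dt_L // (bracketNl (sVt i) (sVt j)) (bracketNr (sVt i) (sVt j)).
rewrite -[in RHS]/(dV i) -[in RHS]/(dV j).
set B := bracket (V i t) (V j t).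
rewrite -[LHS]/(bracket (dV i t) (L j t) x f - B x f + (- B x f + bracket (L i t) (dV j t) x f)).
rewrite -[RHS]/(bracket (dV i t) (L j t) x f + bracket (L i t) (dV j t) x f - (B x f + B x f)).
have E (a b d : R) : a - b + (- b + d) = a + d - (b + b) by ring.
exact: E.
Qed.

Lemma dA_is_derive (t : R) x f : `|t| < eps ->
  is_derive t 1 (fun s => dA s x f) (ddA t x f).
Proof.
move=> te.
have D := is_deriveB (coefsum_is_derive x f te sV) (C_is_derive x f te).
have -> : (fun s => dA s x f) =
    (fun s => coefsum (fun k => V k s) x f) - (fun s => C s x f) by [].
apply: is_derive_eq D _.
set B := bracket (V i t) (V j t).
rewrite -[LHS]/(coefsum (fun k => dV k t) x f - (C' t x f - (B x f + B x f))).
rewrite -[RHS]/(coefsum (fun k => dV k t) x f - C' t x f + (B x f + B x f)).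
by rewrite opprB addrCA addrC.
Qed.

Let tv (X : field M) x : tangent_to VV X -> tangent x (X x).
Proof. by case=> sX _; exact: smooth_field_tangent. Qed.

Lemma near_vertical_tangent (U : R -> field M) (t : R) x : `|t| < eps ->
  (forall s, `|s| < eps -> tangent_to VV (U s)) -> \forall s \near t, tangent x (U s x).
Proof.
by move=> te vU; have := near_time te; apply: filterS => s /vU /tv.
Qed.

(** Measuring the vertical field [A] by the fixed metric [g 0] leaves no term from the variation of
    the metric. *)
Lemma norm_A_is_derive (t : R) x : `|t| < eps ->
  is_derive t 1 (fun s => g 0 x (A s x) (A s x)) (2 * g 0 x (dA t x) (A t x)).
Proof.
move=> te; have gM0 := variation_metric time0.
have tA := near_vertical_tangent x te A_vertical.
have td := tv x (dA_vertical te).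
have dAf f := A_is_derive x f te.
apply: is_derive_eq (metric_is_derive gM0 tA tA td td dAf dAf) _.
rewrite (metricC gM0 (tv x (A_vertical te)) td).
by rewrite mulr_natl mulr2n.
Qed.

Lemma dA_A_is_derive (t : R) x : `|t| < eps ->
  is_derive t 1 (fun s => g 0 x (dA s x) (A s x))
    (g 0 x (ddA t x) (A t x) + g 0 x (dA t x) (dA t x)).
Proof.
move=> te; have gM0 := variation_metric time0.
have tA := near_vertical_tangent x te A_vertical.
have tdA := near_vertical_tangent x te dA_vertical.
exact: (metric_is_derive gM0 tdA tA (tv x (ddA_vertical te)) (tv x (dA_vertical te))
  (fun f => dA_is_derive x f te) (fun f => A_is_derive x f te)).
Qed.

(** Identifies the pointwise choice with the explicit smooth field: what is subtracted from the
    bracket is a combination of lifts, hence horizontal. *)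
Lemma proj_V_bracket t x : `|t| < eps -> proj_V (g t) VV (bracket (L i t) (L j t)) x = A t x.
Proof.
move=> te; have gM := variation_metric te.
apply: (proj_V_eq gM).
  by have [_] := A_vertical te; exact.
have -> : bracket (L i t) (L j t) x - A t x = \sum_k c k (pi x) *: L k t x.
  by rewrite /A /ONeill_tensor opprB addrCA subrr addr0.
have tl k : tangent x (L k t x) by exact: smooth_field_tangent (lift_smooth k te).
split; first by apply: tangent_sum => k _; exact: tangentZ.
move=> w Vw; have tw : tangent x w by case: Vw.
rewrite (metric_suml gM) // big1 // => k _.
by have [[_ ->] // _ _] := lift_spec k x te; rewrite mulr0.
Qed.

(** [sec_lift] holds at all times near [t], so [nabla s] is eliminated before differentiating; 3/2
    is 3/4 times the 2 from the square norm. *)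
Lemma sec_is_derive (nabla : R -> connection M) (t : R) x : i != j ->
  (forall s, `|s| < eps -> levi_civita (g s) (nabla s)) -> `|t| < eps ->
  is_derive t 1 (fun s => sec (g s) (nabla s) (lift s i) (lift s j) x)
    (- (3 / 2) * g 0 x (dA t x) (A t x)).
Proof.
move=> ij nablaP te.
have D := is_deriveD (is_derive_cst (base_curvature gN W i j (pi x)) t 1)
  (is_deriveZ (- (3 / 4)) (norm_A_is_derive x te)).
have E (a : R) : 0 + (- (3 / 4)) *: (2 * a) = - (3 / 2) * a.
  by rewrite -[_ *: _]/(_ * _); lra.
apply: (near_eq_is_derive _ (is_derive_eq D (E _))).
have := near_time te; apply: filterS => s se.
have gHs k y u : tangent y u ->
    g s y (lift s k y) u = gN (pi y) (W k (pi y)) (push pi u) by exact: lift_riesz.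
have sl k := lift_smooth k se; have rl k := lift_related k se.
have -> := sec_lift gNM sW oW (variation_metric se) spi (nablaP s se) sl rl gHs ij x.
have vA := A_vertical se.
have -> : eval2 (g s) (A s) (A s) x = g 0 x (A s x) (A s x).
  exact: (variation_vertical x se vA vA).
exact: (congr1 (fun z => base_curvature gN W i j (pi x) + z) (mulNr _ _)).
Qed.

Lemma sec_is_derive2 (nabla : R -> connection M) (t : R) x : i != j ->
  (forall s, `|s| < eps -> levi_civita (g s) (nabla s)) -> `|t| < eps ->
  is_derive t 1 (derive1 (fun s => sec (g s) (nabla s) (lift s i) (lift s j) x))
    (- (3 / 2) * (g 0 x (ddA t x) (A t x) + g 0 x (dA t x) (dA t x))).
Proof.
move=> ij nablaP te.
have D := is_deriveZ (- (3 / 2)) (dA_A_is_derive x te).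
apply: (near_eq_is_derive _ D); have := near_time te; apply: filterS => s se.
by rewrite derive1E; have [_ E] := sec_is_derive x ij nablaP se; exact: (esym E).
Qed.

Let G (t : R) (X Y : field M) (x : M) := eval2 (g t) X Y x.

Lemma coefsum_metricl (t : R) U x w : `|t| < eps -> (forall k, tangent x (U k x)) -> tangent x w ->
  g t x (coefsum U x) w = \sum_k c k (pi x) * g t x (U k x) w.
Proof.
by move=> te tU tw; rewrite coefsumE (metric_suml (variation_metric te)).
Qed.

Lemma sec_derive_value (t : R) x : `|t| < eps ->
  - (3 / 2) * g 0 x (dA t x) (A t x) =
  - (3 / 2) * (\sum_k c k (pi x) * G t (V k t) (A t) x) + 3 / 2 * G t (C t) (A t) x.
Proof.
move=> te; have gM := variation_metric te.
have vA := A_vertical te; have vdA := dA_vertical te.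
have tA := tv x vA; have tC := tv x (C_vertical te); have tV k := tv x (vV k te).
have tS : tangent x (coefsum (fun k => V k t) x).
  by apply: tv; apply: coefsum_vertical => k; exact: vV.
rewrite -(variation_vertical x te vdA vA).
rewrite -[dA t x]/(coefsum (fun k => V k t) x - C t x) (metricBl gM tS tC tA).
rewrite (coefsum_metricl te tV tA) mulrBr; congr (_ + _).
by rewrite mulNr opprK.
Qed.

(** With [dA] the difference of a sum S and [C], the cross term of its square norm gives the
    coefficient 3, and the doubled bracket in [ddA] gives -3. Every pairing is of vertical fields,
    so [g 0] becomes [g t]. *)
Lemma sec_derive2_value (t : R) x : `|t| < eps ->
  - (3 / 2) * (g 0 x (ddA t x) (A t x) + g 0 x (dA t x) (dA t x)) =
  - (3 / 2) * (\sum_k c k (pi x) * G t (dV k t) (A t) x)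
  - 3 / 2 * (\sum_k \sum_l c k (pi x) * c l (pi x) * G t (V k t) (V l t) x)
  + 3 * (\sum_k c k (pi x) * G t (V k t) (C t) x)
  + 3 / 2 * G t (C' t) (A t) x
  - 3 * G t (bracket (V i t) (V j t)) (A t) x
  - 3 / 2 * G t (C t) (C t) x.
Proof.
move=> te; have gM := variation_metric te.
have vA := A_vertical te; have vdA := dA_vertical te; have vddA := ddA_vertical te.
have vB := VV_bracket_vertical te.
have vC' : tangent_to VV (C' t) by apply: bracket_lift_vertical => //; exact: dV_vertical.
have tA := tv x vA; have tC := tv x (C_vertical te); have tV k := tv x (vV k te).
have tdV k := tv x (dV_vertical k te); have tC' := tv x vC'; have tB := tv x vB.
have tS : tangent x (coefsum (fun k => V k t) x).
  by apply: tv; apply: coefsum_vertical => k; exact: vV.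
have tdS : tangent x (coefsum (fun k => dV k t) x).
  by apply: tv; apply: coefsum_vertical => k; exact: dV_vertical.
rewrite -(variation_vertical x te vddA vA) -(variation_vertical x te vdA vdA).
set B := bracket (V i t) (V j t) in tB *.
rewrite -[ddA t x]/(coefsum (fun k => dV k t) x - C' t x + (B x + B x)).
rewrite -[dA t x]/(coefsum (fun k => V k t) x - C t x).
have tBB := tangentD tB tB; have tSC := tangentB tS tC.
rewrite (metricDl gM (tangentB tdS tC') tBB tA) (metricBl gM tdS tC' tA) (metricDl gM tB tB tA).
rewrite (metricBl gM tS tC tSC) (metricBr gM tS tC tS) (metricBr gM tS tC tC).
rewrite (metricC gM tC tS) (coefsum_metricl te tdV tA) !(coefsum_metricl te tV) //.
have -> : \sum_k c k (pi x) * g t x (V k t x) (coefsum (fun k => V k t) x) =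
    \sum_k \sum_l c k (pi x) * c l (pi x) * G t (V k t) (V l t) x.
  apply: eq_bigr => k _; rewrite coefsumE (metric_sumr gM) // mulr_sumr.
  by apply: eq_bigr => l _; rewrite mulrA.
rewrite /G /eval2.
move: (\sum_k c k (pi x) * g t x (dV k t x) (A t x))
  (\sum_k \sum_l c k (pi x) * c l (pi x) * g t x (V k t x) (V l t x))
  (\sum_k c k (pi x) * g t x (V k t x) (C t x)) (g t x (C' t x) (A t x))
  (g t x (B x) (A t x)) (g t x (C t x) (C t x)) => a b d e h o.
lra.
Qed.

End Variation.

Theorem theorem5p1 (R : realType) (n p : nat)
    (M : manifold R (n + p)) (N : manifold R p) (pi : M -> N)
    (gN : tensor2 N) (eps : R) (g : R -> tensor2 M)
    (W : 'I_p -> field N) (V : 'I_p -> R -> field M)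
    (nabla : R -> connection M) :
  let VV := vertical pi in
  let What (t : R) (i : 'I_p) := proj_H (g t) VV (hlift pi (g 0) (W i)) in
  riem_metric gN ->
  variation VV eps g ->
  (forall t, `|t| < eps -> riem_submersion pi (g t) gN) ->
  (forall i, smooth_field (W i)) ->
  (forall y i j, eval2 gN (W i) (W j) y = (i == j)%:R) ->
  (forall i, time_smooth_field eps (V i)) ->
  (forall i t, `|t| < eps -> tangent_to VV (V i t)) ->
  (forall t, `|t| < eps -> forall X, tangent_to VV X -> forall x,
     sharp (g t) (dt_tensor g t) x (X x) =
     \sum_i eval2 (g 0) (V i t) X x *: What t i x) ->
  (forall t, `|t| < eps -> levi_civita (g t) (nabla t)) ->
  forall i j : 'I_p, i != j ->
  forall (t : R) (x : M), `|t| < eps ->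
  let S (s : R) := sec (g s) (nabla s) (What s i) (What s j) x in
  let c (k : 'I_p) := eval2 gN (bracket (W i) (W j)) (W k) (pi x) in
  let A := proj_V (g t) VV (bracket (What t i) (What t j)) in
  let C : field M := bracket (V i t) (What t j) + bracket (What t i) (V j t) in
  let dV (k : 'I_p) := dt_field (V k) t in
  let C' : field M := bracket (dV i) (What t j) + bracket (What t i) (dV j) in
  let G (X Y : field M) := eval2 (g t) X Y x in
  is_derive t 1 S
    (- (3 / 2) * (\sum_k c k * G (V k t) A) + 3 / 2 * G C A)
  /\
  is_derive t 1 (derive1 S)
    (- (3 / 2) * (\sum_k c k * G (dV k) A)
     - 3 / 2 * (\sum_k \sum_l c k * c l * G (V k t) (V l t))
     + 3 * (\sum_k c k * G (V k t) C)
     + 3 / 2 * G C' A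
     - 3 * G (bracket (V i t) (V j t)) A
     - 3 / 2 * G C C).
Proof.
move=> VV What gNM vg sub sW oW sV vV shV nablaP i j ij t x te S c A C dV C' G.
have AE : A = ONeill_tensor pi gN W (What t) i j.
  by apply/funext => y; exact: (proj_V_bracket gNM vg sub sW oW i j y te).
rewrite AE; split.
- rewrite -[X in is_derive _ _ _ X](sec_derive_value gNM vg sub sW oW vV i j x te).
  exact: (sec_is_derive gNM vg sub sW oW sV vV shV x ij nablaP te).
- rewrite -[X in is_derive _ _ _ X](sec_derive2_value gNM vg sub sW oW sV vV i j x te).
  exact: (sec_is_derive2 gNM vg sub sW oW sV vV shV x ij nablaP te).
Qed.
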